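(* The approximation distance of the unit sphere $S^2\subset\mathbb{R}^3$ by finite $\mathrm{O}_3(\mathbb{R})$-homogeneous spaces, calculated up to 4 digits, is $0.3208$. That is, there is a finite $\mathrm{O}_3(\mathbb{R})$-homogeneous space $X$ such that $d_H(X,S^2)\le d_H(Y,S^2)$ for every finite $\mathrm{O}_3(\mathbb{R})$-homogeneous space $Y$, and the value $d_H(X,S^2)$ equals $0.3208$ to four decimal digits, i.e. $|d_H(X,S^2)-0.3208|\le 5\cdot 10^{-5}$.
   Context: $\mathrm{O}_3(\mathbb{R})$ is the group of linear isometries of $\mathbb{R}^3$, and $S^2=\{v\in\mathbb{R}^3:\|v\|=1\}$. A finite $\mathrm{O}_3(\mathbb{R})$-homogeneous space is a set of the form $Gx=\{gx: g\in G\}\subset\mathbb{R}^3$, where $G$ is a finite subgroup of $\mathrm{O}_3(\mathbb{R})$ and $x\in\mathbb{R}^3$ (the point $x$ need not lie on $S^2$). $d_H$ denotes the Hausdorff distance between nonempty compact subsets of $\mathbb{R}^3$ with respect to the Euclidean metric. A finite $\mathrm{O}_3(\mathbb{R})$-homogeneous space $X$ is an optimal approximation of a set $A\subset\mathbb{R}^3$ if $d_H(X,A)\le d_H(Y,A)$ for every finite $\mathrm{O}_3(\mathbb{R})$-homogeneous space $Y$; in that case $d_H(X,A)$ is called the approximation distance of $A$. *)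

(* Defs.v *)
From HB Require Import structures.
From mathcomp Require Export all_boot all_order all_algebra.
From mathcomp Require Export all_classical all_reals.

Set Implicit Arguments.
Unset Strict Implicit.
Unset Printing Implicit Defensive.
Import Order.TTheory GRing.Theory Num.Theory.
Local Open Scope classical_set_scope.
Local Open Scope ring_scope.

(* Points of R^3 are column vectors, on which matrices act by [*m].  The norm
   `|v| that MathComp-Analysis puts on matrices is the sup norm, so the
   Euclidean norm is defined here. *)
Definition enorm (R : realType) (v : 'cV[R]_3) : R :=
  Num.sqrt (\sum_(i < 3) v i 0 ^+ 2).

Definition edistance (R : realType) (u v : 'cV[R]_3) : R := enorm (u - v).

Definition unit_sphere (R : realType) : set 'cV[R]_3 := [set v | enorm v = 1].
Arguments unit_sphere R : clear implicits.

(* A linear isometry of a finite-dimensional space is automatically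
   invertible. *)
Definition O3 (R : realType) : set 'M[R]_3 :=
  [set g | forall v : 'cV[R]_3, enorm (g *m v) = enorm v].
Arguments O3 R : clear implicits.

Definition finite_subgroup_O3 (R : realType) (G : set 'M[R]_3) : Prop :=
  [/\ finite_set G,
      G `<=` O3 R,
      G 1%:M,
      forall g h : 'M[R]_3, G g -> G h -> G (g *m h)
    & forall g : 'M[R]_3, G g -> G (invmx g)].

Definition orbit3 (R : realType) (G : set 'M[R]_3) (x : 'cV[R]_3) :
  set 'cV[R]_3 := [set g *m x | g in G].

Definition finite_homogeneous (R : realType) (X : set 'cV[R]_3) : Prop :=
  exists (G : set 'M[R]_3) (x : 'cV[R]_3),
    finite_subgroup_O3 G /\ X = orbit3 G x.

(* [sup] and [inf] are the total real-valued operations (equal to 0 on sets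
   without a supremum, resp. infimum); the definitions below are meaningful for
   nonempty compact sets, where all the suprema and infima involved exist. *)
Definition dist_to_set (R : realType) (a : 'cV[R]_3) (B : set 'cV[R]_3) : R :=
  inf [set edistance a b | b in B].

Definition hausdorff_distance (R : realType) (A B : set 'cV[R]_3) : R :=
  Num.max (sup [set dist_to_set a B | a in A])
          (sup [set dist_to_set b A | b in B]).

Definition optimal_approximation (R : realType) (X A : set 'cV[R]_3) : Prop :=
  finite_homogeneous X /\
  forall Y : set 'cV[R]_3, finite_homogeneous Y ->
    hausdorff_distance X A <= hausdorff_distance Y A.

(* Main.v *)
Require Import Defs.
From mathcomp Require Import all_boot all_order all_algebra.
From mathcomp Require Import all_classical all_reals.
From mathcomp Require Import ring lra.
Import Order.TTheory GRing.Theory Num.Theory.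
Local Open Scope classical_set_scope.
Local Open Scope ring_scope.

(** Let an orbit [X = G x] have radius [r = |x|], and write [c] for
    [covering_cos].  For a unit vector [b] the squared distance from [b] to
    [g x] is [1 - 2 <b, g x> + r^2].  If some [b] satisfies [<b, g x> <= c r]
    for all [g], then every point of [X] is at squared distance at least
    [(r - c)^2 + 1 - c^2 >= 1 - c^2] from [b].  So the theorem says how well the
    directions of an orbit can cover the sphere: the best angle is the
    circumradius of the fundamental triangle of the full icosahedral group,
    the spherical triangle with angles [pi/2, pi/3, pi/5], and the
    approximation distance is the sine of that angle.

    Upper bound ([icosahedral_covering]).  The mirrors of the icosahedral group
    cut the sphere into copies of the fundamental triangle.  Let [O] point to
    the circumcentre of one copy.  Given [b], take [g] in the group maximizing
    [<b, g O>]; the reflections in the three walls then show that [g^-1 b] lies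
    in the cone over that triangle, that is, is a nonnegative combination of
    its corners, and [<_, O>] bounds the norm from above on this cone.

    Lower bound ([orbit_missed]).  No classification of the finite subgroups is
    needed, only a rotation of least positive angle in [G].  Let [C] be the
    cosine of half that angle, and let the poles be the unit vectors on the axes
    of the rotations with this angle.  For two poles at angle [delta] the product
    of the rotations has half-angle cosine [C^2 - S^2 cos delta], with
    [S^2 = 1 - C^2]; minimality forces [|cos delta| <= C / (1 + C)] unless the
    axes agree ([poles_angle]).  The poles form a [G]-invariant set, which gives
    two ways to miss a point ([invariant_set_missed]): if the orbit stays away
    from the poles, a pole is missed; if an orbit point is close to a pole, every
    orbit point is, and any point far from all poles is missed.
    - If there is one axis, a vector orthogonal to it is far from the poles.
    - If [C <= 5/7], the poles are so spread out that the direction of [p - q],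
      for poles [p], [q] on distinct axes, is far from all of them.
    - If [C > 5/7], apply the angle bound to [q] and its images [A q], [A^2 q]
      under the rotation [A] about [p]: the inequalities leave only
      [C = golden / 2] and [cos delta = +- 1 / sqrt 5], the icosahedral values
      ([extremal_icosahedral]).  The poles, the midpoints of the edges and the
      centres of the faces then form invariant sets.  If no point were missed,
      [x] would be closer than the circumradius to a point of each; the triangle
      inequality makes these three points the corners of one fundamental
      triangle, and no point is that close to all three corners
      ([icosahedral_missed]). *)

Set Implicit Arguments.
Unset Strict Implicit.
Unset Printing Implicit Defensive.

(** * Inner product and matrices of size three *)

Definition dot (R : realType) (u v : 'cV[R]_3) : R := (u^T *m v) 0 0.

(* Canonical forms of the three indices, so that entries of explicit matrices
   compute. *)
Notation i0 := (@Ordinal 3 0 isT).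
Notation i1 := (@Ordinal 3 1 isT).
Notation i2 := (@Ordinal 3 2 isT).

Definition vec3 (R : realType) (x y z : R) : 'cV[R]_3 :=
  \col_i nth 0 [:: x; y; z] i.

Definition mat3 (R : realType) (a b c d e f g h i : R) : 'M[R]_3 :=
  \matrix_(j, k) nth 0 (nth [::] [:: [:: a; b; c]; [:: d; e; f]; [:: g; h; i]] j) k.

Lemma big3 (R : realType) (F : 'I_3 -> R) : \sum_(i < 3) F i = F i0 + F i1 + F i2.
Proof.
rewrite !big_ord_recl big_ord0 addr0 addrA.
congr (F _ + F _ + F _); apply: ord_inj => //=.
Qed.

Lemma ord3P (P : 'I_3 -> Prop) : P i0 -> P i1 -> P i2 -> forall i, P i.
Proof.
move=> P0 P1 P2 [[|[|[|//]]] lt_i].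
- by rewrite (_ : Ordinal lt_i = i0) //; apply: ord_inj.
- by rewrite (_ : Ordinal lt_i = i1) //; apply: ord_inj.
- by rewrite (_ : Ordinal lt_i = i2) //; apply: ord_inj.
Qed.

Lemma vec3_eta (R : realType) (v : 'cV[R]_3) : v = vec3 (v i0 0) (v i1 0) (v i2 0).
Proof. by apply/colP; apply: ord3P; rewrite mxE. Qed.

Lemma mat3_eta (R : realType) (A : 'M[R]_3) :
  A = mat3 (A i0 i0) (A i0 i1) (A i0 i2) (A i1 i0) (A i1 i1) (A i1 i2)
           (A i2 i0) (A i2 i1) (A i2 i2).
Proof. by apply/matrixP; apply: ord3P; apply: ord3P; rewrite mxE. Qed.

Lemma mat3_mul (R : realType) (a b c d e f g h i a' b' c' d' e' f' g' h' i' : R) :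
  mat3 a b c d e f g h i *m mat3 a' b' c' d' e' f' g' h' i' =
  mat3 (a * a' + b * d' + c * g') (a * b' + b * e' + c * h') (a * c' + b * f' + c * i')
       (d * a' + e * d' + f * g') (d * b' + e * e' + f * h') (d * c' + e * f' + f * i')
       (g * a' + h * d' + i * g') (g * b' + h * e' + i * h') (g * c' + h * f' + i * i').
Proof. by apply/matrixP; apply: ord3P; apply: ord3P; rewrite !mxE big3 !mxE. Qed.

Lemma mat3_vec (R : realType) (a b c d e f g h i x y z : R) :
  mat3 a b c d e f g h i *m vec3 x y z =
  vec3 (a * x + b * y + c * z) (d * x + e * y + f * z) (g * x + h * y + i * z).
Proof. by apply/colP; apply: ord3P; rewrite !mxE big3 !mxE. Qed.

Lemma mat3_tr (R : realType) (a b c d e f g h i : R) :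
  (mat3 a b c d e f g h i)^T = mat3 a d g b e h c f i.
Proof. by apply/matrixP; apply: ord3P; apply: ord3P; rewrite !mxE. Qed.

Lemma mat3_trace (R : realType) (a b c d e f g h i : R) :
  \tr (mat3 a b c d e f g h i) = a + e + i.
Proof. by rewrite /mxtrace big3 !mxE. Qed.

Lemma mat3_1 (R : realType) : 1%:M = mat3 1 0 0 0 1 0 0 0 1 :> 'M[R]_3.
Proof. by apply/matrixP; apply: ord3P; apply: ord3P; rewrite !mxE. Qed.

Lemma mat3_det (R : realType) (a b c d e f g h i : R) :
  \det (mat3 a b c d e f g h i) =
  a * (e * i - f * h) - b * (d * i - f * g) + c * (d * h - e * g).
Proof.
rewrite (expand_det_row _ i0) big3 /cofactor.
rewrite !(expand_det_row _ ord0) !big_ord_recl !big_ord0 /cofactor !det_mx11 !mxE /=.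
rewrite /bump /=.
ring.
Qed.
 
Lemma vec3_dot (R : realType) (x y z x' y' z' : R) :
  dot (vec3 x y z) (vec3 x' y' z') = x * x' + y * y' + z * z'.
Proof. by rewrite /dot mxE big3 !mxE. Qed.

Lemma dotE (R : realType) (u v : 'cV[R]_3) :
  dot u v = u i0 0 * v i0 0 + u i1 0 * v i1 0 + u i2 0 * v i2 0.
Proof. by rewrite /dot mxE big3 !mxE. Qed.

Lemma dotC (R : realType) (u v : 'cV[R]_3) : dot u v = dot v u.
Proof. by rewrite !dotE; ring. Qed.
Lemma dotDl (R : realType) (u v w : 'cV[R]_3) : dot (u + v) w = dot u w + dot v w.
Proof. by rewrite !dotE !mxE; ring. Qed.
Lemma dotDr (R : realType) (u v w : 'cV[R]_3) : dot w (u + v) = dot w u + dot w v.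
Proof. by rewrite !dotE !mxE; ring. Qed.
Lemma dotZl (R : realType) a (u w : 'cV[R]_3) : dot (a *: u) w = a * dot u w.
Proof. by rewrite !dotE !mxE; ring. Qed.
Lemma dotZr (R : realType) a (u w : 'cV[R]_3) : dot w (a *: u) = a * dot w u.
Proof. by rewrite !dotE !mxE; ring. Qed.
Lemma dotNl (R : realType) (u w : 'cV[R]_3) : dot (- u) w = - dot u w.
Proof. by rewrite !dotE !mxE; ring. Qed.
Lemma dotNr (R : realType) (u w : 'cV[R]_3) : dot w (- u) = - dot w u.
Proof. by rewrite !dotE !mxE; ring. Qed.
Lemma dot0l (R : realType) (w : 'cV[R]_3) : dot 0 w = 0.
Proof. by rewrite !dotE !mxE; ring. Qed.

Definition dot_linear :=
  (dotDl, dotDr, dotZl, dotZr, dotNl, dotNr).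

Lemma dot_ge0 (R : realType) (u : 'cV[R]_3) : 0 <= dot u u.
Proof. by rewrite dotE -!expr2 !addr_ge0 ?sqr_ge0. Qed.

Lemma dot_eq0 (R : realType) (u : 'cV[R]_3) : dot u u = 0 -> u = 0.
Proof.
rewrite dotE => u0; apply/colP; apply: ord3P; rewrite mxE; nra.
Qed.

Lemma dot_gt0 (R : realType) (u : 'cV[R]_3) : u != 0 -> 0 < dot u u.
Proof.
move=> u0; rewrite lt_neqAle dot_ge0 andbT eq_sym.
by apply: contraNneq u0 => /dot_eq0 ->.
Qed.

Lemma enormE (R : realType) (u : 'cV[R]_3) : enorm u = Num.sqrt (dot u u).
Proof. by rewrite /enorm big3 dotE !expr2. Qed.

Lemma cauchy_schwarz (R : realType) (u v : 'cV[R]_3) :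
  dot u v ^+ 2 <= dot u u * dot v v.
Proof.
have := dot_ge0 (dot v v *: u - dot u v *: v).
rewrite !dot_linear (dotC v u).
have [v0|v0] := eqVneq (dot v v) 0.
  by rewrite (dot_eq0 v0) (dotC u) !dot0l expr0n !mulr0.
have : 0 < dot v v by rewrite lt_def v0 dot_ge0.
move: (dot u u) (dot u v) (dot v v) => a b c; nra.
Qed.

Definition cross (R : realType) (u v : 'cV[R]_3) : 'cV[R]_3 :=
  vec3 (u i1 0 * v i2 0 - u i2 0 * v i1 0)
       (u i2 0 * v i0 0 - u i0 0 * v i2 0)
       (u i0 0 * v i1 0 - u i1 0 * v i0 0).

(** The matrix with columns [u], [v], [0] is singular, so some nonzero row
    vector annihilates it. *)
Lemma exists_orthogonal_unit (R : realType) (u v : 'cV[R]_3) :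
  exists a, [/\ dot a a = 1, dot a u = 0 & dot a v = 0].
Proof.
have /det0P [w w0 wM] : \det (mat3 (u i0 0) (v i0 0) 0 (u i1 0) (v i1 0) 0
   (u i2 0) (v i2 0) 0) == 0 by rewrite mat3_det; apply/eqP; ring.
have a0 : 0 < dot w^T w^T.
  by apply: dot_gt0; apply: contraNneq w0 => w0; rewrite -(trmxK w) w0 trmx0.
set s := Num.sqrt (dot w^T w^T).
have s0 : 0 < s by rewrite sqrtr_gt0.
have ss : s ^+ 2 = dot w^T w^T by rewrite sqr_sqrtr // ltW.
have wu : dot w^T u = 0.
  move/rowP/(_ i0): wM; rewrite !mxE big3 !mxE /= => <-.
  by rewrite dotE !mxE.
have wv : dot w^T v = 0.
  move/rowP/(_ i1): wM; rewrite !mxE big3 !mxE /= => <-.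
  by rewrite dotE !mxE.
exists (s^-1 *: w^T); rewrite !dot_linear wu wv !mulr0; split=> //.
by rewrite -ss; field; rewrite gt_eqF.
Qed.

(** * Orthogonal matrices *)

Lemma O3_dot (R : realType) (g : 'M[R]_3) : O3 R g ->
  forall u v, dot (g *m u) (g *m v) = dot u v.
Proof.
move=> gO.
have norm w : dot (g *m w) (g *m w) = dot w w.
  have /(congr1 (fun x => x ^+ 2)) := gO w.
  by rewrite !enormE !sqr_sqrtr ?dot_ge0.
move=> u v; have := norm (u + v).
rewrite mulmxDr !dot_linear !norm (dotC v) (dotC (g *m v)); lra.
Qed.

Lemma dot_mxE (R : realType) (A : 'M[R]_3) u v :
  dot u (A *m v) = dot (A^T *m u) v.
Proof. by rewrite /dot trmx_mul trmxK mulmxA. Qed.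

Lemma dot_inj (R : realType) (u v : 'cV[R]_3) :
  (forall w, dot w u = dot w v) -> u = v.
Proof.
move=> H; apply/eqP; rewrite -subr_eq0; apply/eqP; apply: dot_eq0.
by have := H (u - v); rewrite !dot_linear; lra.
Qed.

Lemma mx3_inj (R : realType) (A B : 'M[R]_3) : (forall v : 'cV_3, A *m v = B *m v) -> A = B.
Proof.
move=> H; apply/matrixP => i j.
have := congr1 (fun M : 'cV_3 => M i 0) (H (delta_mx j 0)).
by rewrite -!colE !mxE.
Qed.

Lemma O3_tr (R : realType) (g : 'M[R]_3) : O3 R g -> g^T *m g = 1%:M.
Proof.
move=> gO; apply: mx3_inj => v; apply: dot_inj => w.
by rewrite -mulmxA dot_mxE trmxK O3_dot // mul1mx.
Qed.

Lemma O3_invmx (R : realType) (g : 'M[R]_3) : O3 R g -> invmx g = g^T.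
Proof.
move=> /O3_tr gT; have [gU _] := mulmx1_unit (mulmx1C gT).
by rewrite -[LHS]mul1mx -gT -mulmxA mulmxV ?mulmx1.
Qed.

Lemma O3_det (R : realType) (g : 'M[R]_3) : O3 R g -> \det g = 1 \/ \det g = - 1.
Proof.
move=> /O3_tr /(congr1 determinant); rewrite det_mulmx det_tr det1 => h.
have /eqP : (\det g - 1) * (\det g + 1) = 0 by rewrite mulrDr mulrBl h; ring.
by rewrite mulf_eq0 subr_eq0 addr_eq0 => /orP [] /eqP; [left|right].
Qed.

Lemma O3_of_tr (R : realType) (g : 'M[R]_3) : g^T *m g = 1%:M -> O3 R g.
Proof.
by move=> gT v; rewrite !enormE dot_mxE mulmxA gT mul1mx.
Qed.

Lemma O3_trC (R : realType) (g : 'M[R]_3) : O3 R g -> g *m g^T = 1%:M.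
Proof. by move/O3_tr/mulmx1C. Qed.

(** * Rotations as unit quaternions *)

(** The matrix of [a |-> q a q^*] on imaginary quaternions, where [q] has real
    part [w] and imaginary part [v].  For a unit quaternion this is the rotation
    about [v] by twice the angle whose cosine is [w]. *)
Definition quat_mx (R : realType) (w : R) (v : 'cV[R]_3) : 'M[R]_3 :=
  let x := v i0 0 in let y := v i1 0 in let z := v i2 0 in
  mat3 (w ^+ 2 + x ^+ 2 - y ^+ 2 - z ^+ 2) (2 * (x * y - w * z)) (2 * (x * z + w * y))
       (2 * (x * y + w * z)) (w ^+ 2 - x ^+ 2 + y ^+ 2 - z ^+ 2) (2 * (y * z - w * x))
       (2 * (x * z - w * y)) (2 * (y * z + w * x)) (w ^+ 2 - x ^+ 2 - y ^+ 2 + z ^+ 2).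

Lemma quat_mx_vec (R : realType) (w : R) (v a : 'cV[R]_3) :
  quat_mx w v *m a =
  (w ^+ 2 - dot v v) *: a + (2 * w) *: cross v a + (2 * dot v a) *: v.
Proof.
rewrite [in LHS](vec3_eta a) mat3_vec !dotE.
by apply/colP; apply: ord3P; rewrite !mxE /=; ring.
Qed.

Lemma quat_mx_mul (R : realType) (w w' : R) (v v' : 'cV[R]_3) :
  quat_mx w v *m quat_mx w' v' =
  quat_mx (w * w' - dot v v') (w *: v' + w' *: v + cross v v').
Proof.
rewrite mat3_mul /quat_mx !dotE !mxE /=.
by congr mat3; ring.
Qed.

Lemma quat_mx_tr (R : realType) (w : R) (v : 'cV[R]_3) :
  (quat_mx w v)^T = quat_mx w (- v).
Proof. by rewrite mat3_tr /quat_mx !mxE; congr mat3; ring. Qed.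

Lemma quat_mxN (R : realType) (w : R) (v : 'cV[R]_3) :
  quat_mx (- w) (- v) = quat_mx w v.
Proof. by rewrite /quat_mx !mxE; congr mat3; ring. Qed.

Lemma quat_mx_trace (R : realType) (w : R) (v : 'cV[R]_3) :
  \tr (quat_mx w v) = 3 * w ^+ 2 - dot v v.
Proof. by rewrite mat3_trace dotE; ring. Qed.

Lemma quat_mx_det (R : realType) (w : R) (v : 'cV[R]_3) :
  \det (quat_mx w v) = (w ^+ 2 + dot v v) ^+ 3.
Proof. by rewrite mat3_det dotE; ring. Qed.

Lemma quat_mx_1 (R : realType) (w : R) : w ^+ 2 = 1 -> quat_mx w 0 = 1%:M.
Proof. by move=> w1; rewrite mat3_1 /quat_mx !mxE; congr mat3; rewrite ?w1; ring. Qed.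

Lemma quat_mx_eq1 (R : realType) (w : R) (v : 'cV[R]_3) :
  w ^+ 2 + dot v v = 1 -> quat_mx w v = 1%:M -> v = 0.
Proof.
move=> wv /(congr1 mxtrace); rewrite quat_mx_trace mxtrace1 => tr.
apply: dot_eq0; lra.
Qed.

Lemma quat_mul_norm (R : realType) (w w' : R) (v v' : 'cV[R]_3) :
  let v'' := w *: v' + w' *: v + cross v v' in
  (w * w' - dot v v') ^+ 2 + dot v'' v'' = (w ^+ 2 + dot v v) * (w' ^+ 2 + dot v' v').
Proof. rewrite /= !dotE !mxE /=; ring. Qed.

(** The cofactor matrix, which acts on cross products, is [det g] times the
    inverse transpose of [g], and the latter is [g] itself. *)
Lemma cross_O3 (R : realType) (g : 'M[R]_3) (u v : 'cV[R]_3) : O3 R g ->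
  cross (g *m u) (g *m v) = \det g *: (g *m cross u v).
Proof.
move=> gO.
have E : g^T *m cross (g *m u) (g *m v) = \det g *: cross u v.
  rewrite (mat3_eta g) (vec3_eta u) (vec3_eta v) mat3_tr mat3_det !mat3_vec.
  by apply/colP; apply: ord3P; rewrite /cross !mxE /=; ring.
by rewrite scalemxAr -E mulmxA O3_trC // mul1mx.
Qed.

(** A conjugate of a rotation has the transported axis, with the sense of
    rotation reversed by an orientation-reversing [g]. *)
Lemma quat_mx_conj (R : realType) (g : 'M[R]_3) (w : R) (v : 'cV[R]_3) : O3 R g ->
  g *m quat_mx w v *m g^T = quat_mx w (\det g *: (g *m v)).
Proof.
move=> gO; apply: mx3_inj => a.
have -> : a = g *m (g^T *m a) by rewrite mulmxA O3_trC // mul1mx.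
set b := g^T *m a.
rewrite -!mulmxA [g^T *m _]mulmxA O3_tr // mul1mx !quat_mx_vec.
have d2 : \det g * \det g = 1 by case: (O3_det gO) => ->; ring.
have -> : cross (\det g *: (g *m v)) (g *m b) = g *m cross v b.
  have -> : cross (\det g *: (g *m v)) (g *m b) = \det g *: cross (g *m v) (g *m b).
    by apply/colP; apply: ord3P; rewrite !mxE /=; ring.
  by rewrite cross_O3 // scalerA d2 scale1r.
rewrite !dotZl !dotZr !O3_dot // mulrA d2 mul1r scalerA.
rewrite (_ : 2 * (\det g * dot v b) * \det g = 2 * dot v b); last first.
  by rewrite -[in RHS](mulr1 2) -d2; ring.
by rewrite !mulmxDr -!scalemxAr.
Qed.

(** Euler's theorem: [g - 1 = - g (g - 1)^T], and in odd dimension the sign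
    makes the determinant vanish. *)
Lemma rotation_axis (R : realType) (g : 'M[R]_3) : O3 R g -> \det g = 1 ->
  exists p, dot p p = 1 /\ g *m p = p.
Proof.
move=> gO g1.
have d0 : \det (g - 1%:M)^T == 0.
  have E : g - 1%:M = g *m (- (g - 1%:M)^T).
    by rewrite linearB /= trmx1 opprB mulmxBr mulmx1 O3_trC.
  have := congr1 determinant E.
  rewrite det_mulmx g1 mul1r -(scaleN1r (g - 1%:M)^T) detZ det_tr -signr_odd /= expr1 mulN1r.
  by move=> h; apply/eqP; lra.
have /det0P [w w0 wM] := d0.
have fix_w : g *m w^T = w^T.
  apply/eqP; rewrite -subr_eq0 -[X in _ - X]mul1mx -mulmxBl.
  by rewrite -(trmxK (g - _)) -trmx_mul wM trmx0.
have a0 : 0 < dot w^T w^T.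
  by apply: dot_gt0; apply: contraNneq w0 => w0; rewrite -(trmxK w) w0 trmx0.
set s := Num.sqrt (dot w^T w^T).
have s0 : 0 < s by rewrite sqrtr_gt0.
have ss : s ^+ 2 = dot w^T w^T by rewrite sqr_sqrtr // ltW.
exists (s^-1 *: w^T); rewrite -scalemxAr fix_w !dot_linear; split=> //.
by rewrite -ss; field; rewrite gt_eqF.
Qed.

Lemma exists_half_angle (R : realType) (c s : R) : c ^+ 2 + s ^+ 2 = 1 ->
  exists C S, [/\ C ^+ 2 + S ^+ 2 = 1, C ^+ 2 - S ^+ 2 = c & 2 * (C * S) = s].
Proof.
move=> cs.
have c1 : 0 <= (1 + c) / 2 by nra.
have c2 : 0 <= (1 - c) / 2 by nra.
have [e [e2 es]] : exists e : R, e ^+ 2 = 1 /\ e * `|s| = s.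
  case: (lerP 0 s) => s0; [exists 1; rewrite ger0_norm // | exists (- 1); rewrite ltr0_norm //];
    by split; ring.
exists (Num.sqrt ((1 + c) / 2)), (e * Num.sqrt ((1 - c) / 2)).
have E : 2 * (Num.sqrt ((1 + c) / 2) * Num.sqrt ((1 - c) / 2)) = `|s|.
  rewrite -sqrtrM // -sqrtr_sqr.
  have -> : s ^+ 2 = 2 ^+ 2 * ((1 + c) / 2 * ((1 - c) / 2)) by lra.
  by rewrite [RHS]sqrtrM ?sqr_ge0 // sqrtr_sqr ger0_norm.
rewrite exprMn e2 !sqr_sqrtr //; split; [lra | lra |].
by rewrite -[RHS]es -E; ring.
Qed.

(** In an orthonormal frame starting with the axis, [g] is a plane rotation; the
    half angle of the latter gives the quaternion. *)
Lemma rotation_quat (R : realType) (g : 'M[R]_3) : O3 R g -> \det g = 1 ->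
  exists w v, w ^+ 2 + dot v v = 1 /\ g = quat_mx w v.
Proof.
move=> gO g1; have [p [p1 gp]] := rotation_axis gO g1.
have [a [a1 ap _]] := exists_orthogonal_unit p p.
pose b := cross p a.
pose B := mat3 (p i0 0) (a i0 0) (b i0 0) (p i1 0) (a i1 0) (b i1 0)
               (p i2 0) (a i2 0) (b i2 0).
have bp : dot b p = 0 by rewrite dotE !mxE /=; ring.
have ba : dot b a = 0 by rewrite dotE !mxE /=; ring.
have b1 : dot b b = 1.
  have : dot b b = dot p p * dot a a - dot a p ^+ 2 by rewrite !dotE !mxE /=; ring.
  by rewrite p1 a1 ap => ->; ring.
have BT : B^T *m B = 1%:M.
  move: p1 a1 b1 ap bp ba; rewrite !dotE => p1 a1 b1 ap bp ba.
  by rewrite mat3_tr mat3_mul mat3_1; congr mat3; lra.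
have BO := O3_of_tr BT.
pose e := vec3 1 0 0 : 'cV[R]_3.
have Be : B *m e = p.
  by rewrite mat3_vec [RHS]vec3_eta; congr vec3; ring.
have gTp : g^T *m p = p by rewrite -{1}gp mulmxA O3_tr // mul1mx.
pose h := B^T *m g *m B.
have he : h *m e = e by rewrite -!mulmxA Be gp -Be mulmxA BT mul1mx.
have hTe : h^T *m e = e.
  by rewrite !trmx_mul trmxK -!mulmxA Be gTp -Be mulmxA BT mul1mx.
have hT : h^T *m h = 1%:M.
  rewrite /h !trmx_mul trmxK -!mulmxA (mulmxA B) O3_trC // mul1mx (mulmxA g^T).
  by rewrite O3_tr // mul1mx.
have h1 : \det h = 1.
  by rewrite /h !det_mulmx g1 mulr1 -det_mulmx BT det1.
have gE : g = B *m h *m B^T.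
  by rewrite /h -!mulmxA O3_trC // mulmx1 mulmxA O3_trC // mul1mx.
clearbody h.
have [w [v [wv hE]]] : exists w v, w ^+ 2 + dot v v = 1 /\ h = quat_mx w v.
  move: he hTe hT h1; rewrite (mat3_eta h) mat3_tr mat3_mul !mat3_vec mat3_det mat3_1.
  move: (h i0 i0) (h i0 i1) (h i0 i2) (h i1 i0) (h i1 i1) (h i1 i2) (h i2 i0)
    (h i2 i1) (h i2 i2) => h00 h01 h02 h10 h11 h12 h20 h21 h22 he hTe hT h1.
  have H (i : 'I_3) := congr1 (fun M : 'cV[R]_3 => M i 0) he.
  have HT (i : 'I_3) := congr1 (fun M : 'cV[R]_3 => M i 0) hTe.
  have HH (i j : 'I_3) := congr1 (fun M : 'M[R]_3 => M i j) hT.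
  have := (H i0, H i1, H i2, HT i1, HT i2, HH i1 i1, HH i2 i2).
  rewrite !mxE /= !(mulr0, mulr1, addr0) => -[[[[[[E1 E2] E3] E4] E5] E6] E7].
  move: E6 E7 h1; rewrite E1 E2 E3 E4 E5 => E6 E7 h1.
  have f0 : (h22 - h11) ^+ 2 + (h12 + h21) ^+ 2 = 0 by lra.
  move/eqP: f0; rewrite paddr_eq0 ?sqr_ge0 // !sqrf_eq0 subr_eq0 addr_eq0.
  case/andP=> /eqP -> /eqP ->.
  have /exists_half_angle [C [S [CS c s]]] : h11 ^+ 2 + h21 ^+ 2 = 1 by nra.
  exists C, (vec3 S 0 0); split; first by rewrite vec3_dot -CS; ring.
  by rewrite /quat_mx !mxE /=; congr mat3; nra.
exists w, (\det B *: (B *m v)); split; last by rewrite -quat_mx_conj // -hE.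
rewrite !dot_linear O3_dot // mulrA.
have -> : \det B * \det B = 1 by case: (O3_det BO) => ->; ring.
by rewrite mul1r.
Qed.

(** * The extremal constants *)

Definition golden (R : realType) : R := (1 + Num.sqrt 5) / 2.

(** Norm of the vertices [(0, 1, golden)] of the icosahedron used below. *)
Definition vertex_norm (R : realType) : R := Num.sqrt (2 + golden R).

(** The vector having inner product 1 with the unit vectors along the corners
    [(0, 0, 1)], [(0, 1, golden)] and [(1, 0, golden^2)] of a fundamental
    triangle: an edge midpoint, a vertex and a face centre of the icosahedron. *)
Definition circumcenter (R : realType) : 'cV[R]_3 :=
  vec3 (Num.sqrt 3 * golden R - golden R ^+ 2) (vertex_norm R - golden R) 1.

Definition covering_cos (R : realType) : R :=
  (enorm (circumcenter R))^-1.

Lemma sqrt_between (R : realType) (x a b : R) : 0 <= a -> 0 <= b ->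
  a ^+ 2 < x -> x < b ^+ 2 -> a < Num.sqrt x < b.
Proof.
move=> a0 b0 ax xb.
have x0 : 0 <= x by apply: le_trans (sqr_ge0 a) (ltW ax).
by rewrite -(ltr_pXn2r (n := 2)) ?nnegrE ?sqrtr_ge0 // sqr_sqrtr // ax /=
  -(ltr_pXn2r (n := 2)) ?nnegrE ?sqrtr_ge0 // sqr_sqrtr.
Qed.

Lemma golden_sqr (R : realType) : golden R ^+ 2 = golden R + 1.
Proof.
have : Num.sqrt (5 : R) ^+ 2 = 5 by rewrite sqr_sqrtr.
by rewrite /golden; move: (Num.sqrt 5) => s s2; lra.
Qed.

(** The bounds below are by continued-fraction convergents, sharp enough for four
    digits of the approximation distance. *)
Lemma golden_bounds (R : realType) : 987 / 610 < golden R < 1597 / 987.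
Proof.
have /andP [] : 682 / 305 < Num.sqrt (5 : R) < 2207 / 987.
  by apply: sqrt_between; lra.
by rewrite /golden => *; apply/andP; split; lra.
Qed.

Lemma vertex_norm_sqr (R : realType) : vertex_norm R ^+ 2 = 2 + golden R.
Proof. by have /andP [? ?] := golden_bounds R; rewrite sqr_sqrtr //; lra. Qed.

Lemma vertex_norm_bounds (R : realType) :
  991 / 521 < vertex_norm R < 1710 / 899.
Proof. by have /andP [? ?] := golden_bounds R; apply: sqrt_between; lra. Qed.

Lemma sqrt3_bounds (R : realType) :
  989 / 571 < Num.sqrt (3 : R) < 1351 / 780.
Proof. by apply: sqrt_between; lra. Qed.

Lemma circumcenter_norm_bounds (R : realType) :
  515 / 462 < dot (circumcenter R) (circumcenter R) < 68 / 61.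
Proof.
have /andP [g1 g2] := golden_bounds R; have /andP [t1 t2] := vertex_norm_bounds R.
have /andP [s1 s2] := sqrt3_bounds R.
rewrite vec3_dot.
set y := vertex_norm R - _; set x := _ * _ - _.
have y1 : 123 / 433 < y < 25 / 88 by apply/andP; split; rewrite /y; lra.
have x1 : 19 / 103 < x < 50 / 271.
  by rewrite /x golden_sqr; apply/andP; split; nra.
case/andP: y1 => y1 y2; case/andP: x1 => x1 x2.
by apply/andP; split; nra.
Qed.

Lemma covering_cos_gt0 (R : realType) : 0 < covering_cos R.
Proof.
have /andP [d1 d2] := circumcenter_norm_bounds R.
by rewrite invr_gt0 enormE sqrtr_gt0; lra.
Qed.

Lemma covering_cos_sqr (R : realType) :
  covering_cos R ^+ 2 = (dot (circumcenter R) (circumcenter R))^-1.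
Proof. by rewrite exprVn enormE sqr_sqrtr // dot_ge0. Qed.

Lemma covering_cos_sqr_bounds (R : realType) :
  61 / 68 < covering_cos R ^+ 2 < 462 / 515.
Proof.
have /andP [d1 d2] := circumcenter_norm_bounds R.
rewrite covering_cos_sqr; move: (dot _ _) d1 d2 => d d1 d2.
have d0 : 0 < d^-1 by rewrite invr_gt0; lra.
have : d * d^-1 = 1 by rewrite mulfV // gt_eqF //; lra.
by move: d^-1 d0 => e e0 de; apply/andP; split; nra.
Qed.

Lemma golden_coarse (R : realType) : 8 / 5 < golden R < 13 / 8.
Proof. by have /andP [? ?] := golden_bounds R; apply/andP; split; lra. Qed.

Lemma vertex_norm_gt (R : realType) : 19 / 10 < vertex_norm R.
Proof. by have /andP [? ?] := vertex_norm_bounds R; lra. Qed.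

Lemma sqrt3_gt (R : realType) : 12 / 7 < Num.sqrt (3 : R).
Proof. by have /andP [? ?] := sqrt3_bounds R; lra. Qed.

Lemma covering_cos_double_gt (R : realType) : 79 / 100 < 2 * covering_cos R ^+ 2 - 1.
Proof. by have /andP [? ?] := covering_cos_sqr_bounds R; lra. Qed.

(** The circumcentre is interior to the fundamental triangle: up to
    positive factors, the coordinates with respect to the three corners are the
    first two quantities and the gap in the third inequality.  That gap is narrow
    because a small right spherical triangle has its circumcentre near the
    hypotenuse. *)
Lemma circumcenter_weights (R : realType) :
  [/\ 0 < vertex_norm R - golden R, 0 < Num.sqrt 3 - golden R &
   golden R * (vertex_norm R - golden R) +
   (2 * golden R + 1) * (Num.sqrt 3 - golden R) < 1].
Proof.
have /andP [g_lo g_hi] := golden_bounds R; have /andP [t_lo t_hi] := vertex_norm_bounds R.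
have /andP [s_lo s_hi] := sqrt3_bounds R.
have a_hi : vertex_norm R - golden R < 2 / 7 by lra.
have d_hi : Num.sqrt 3 - golden R < 10 / 87 by lra.
have a_lo : 0 < vertex_norm R - golden R by lra.
have d_lo : 0 < Num.sqrt 3 - golden R by lra.
have g0 : 0 < golden R < 34 / 21 + 1/1000 by apply/andP; split; lra.
split=> //; move: a_hi d_hi a_lo d_lo g0 => {g_lo g_hi t_lo t_hi s_lo s_hi}.
move: (vertex_norm R - _) (Num.sqrt 3 - _) => a d; move: (golden R) => g.
by move=> ah dh a0 d0 /andP [g0 g1]; nra.
Qed.

Lemma circumcenter_norm_gt0 (R : realType) :
  0 < dot (circumcenter R) (circumcenter R).
Proof. by have /andP [? _] := circumcenter_norm_bounds R; lra. Qed.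

(** * Directions missed by an orbit *)

Definition missed (R : realType) (G : set 'M[R]_3) (x : 'cV[R]_3) :=
  exists b, dot b b = 1 /\ forall g, G g -> dot b (g *m x) <= covering_cos R.

Lemma unit_dot_le1 (R : realType) (u v : 'cV[R]_3) :
  dot u u = 1 -> dot v v = 1 -> dot u v ^+ 2 <= 1.
Proof. by move=> u1 v1; have := cauchy_schwarz u v; rewrite u1 v1 mulr1. Qed.

(** The triangle inequality for angles: if the directions of [u] and [v] are both
    within [arccos c] of [x], then they are within twice that angle of each
    other.  Cauchy-Schwarz for [x] and [b u + a v] gives it without angles. *)
Lemma near_common_point (R : realType) (c : R) (x u v : 'cV[R]_3) (a b : R) :
  0 < c -> 0 < a -> 0 < b -> dot x x = 1 ->
  dot u u = a ^+ 2 -> dot v v = b ^+ 2 -> c * a < dot x u -> c * b < dot x v ->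
  (2 * c ^+ 2 - 1) * (a * b) < dot u v.
Proof.
move=> c0 a0 b0 x1 uu vv xu xv.
have := cauchy_schwarz x (b *: u + a *: v).
rewrite x1 mul1r !dot_linear uu vv (dotC v u) => cs.
have ab : 0 < a * b by apply: mulr_gt0.
have cab : 0 < c * (a * b) by apply: mulr_gt0.
have : 2 * (c * (a * b)) < b * dot x u + a * dot x v.
  have h1 : b * (c * a) < b * dot x u by rewrite ltr_pM2l.
  have h2 : a * (c * b) < a * dot x v by rewrite ltr_pM2l.
  lra.
move: cs; set s := _ + _ => cs sl.
have : (2 * (c * (a * b))) ^+ 2 < s ^+ 2 by rewrite ltr_pXn2r ?nnegrE //; lra.
move/lt_le_trans/(_ cs) => h.
by rewrite -(ltr_pM2l ab); lra.
Qed.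

Lemma subgroup_tr (R : realType) (G : set 'M[R]_3) g :
  finite_subgroup_O3 G -> G g -> G g^T.
Proof. by case=> _ GO _ _ GV Gg; rewrite -O3_invmx; [apply: GV | apply: GO]. Qed.

(** Either [x] is not close to [P], and then by invariance the orbit of [x] misses
    [p0]; or the whole orbit stays close to [P], and it misses any [a] at more
    than twice the covering angle from [P]. *)
Lemma invariant_set_missed (R : realType) (G : set 'M[R]_3) (P : set 'cV[R]_3) x p0 a :
  finite_subgroup_O3 G -> dot x x = 1 ->
  (forall g p, G g -> P p -> P (g *m p)) -> (forall p, P p -> dot p p = 1) ->
  P p0 -> dot a a = 1 -> (forall p, P p -> dot a p <= 2 * covering_cos R ^+ 2 - 1) ->
  missed G x.
Proof.
move=> GG x1 PG P1 Pp0 a1 aP.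
have [[p Pp pc]|no] := pselect (exists2 p, P p & covering_cos R < dot x p).
  exists a; split=> // g Gg; rewrite leNgt; apply/negP => ag.
  have gO : O3 R g by case: GG => _ GO _ _ _; apply: GO.
  have := @near_common_point _ (covering_cos R) (g *m x) a (g *m p) 1 1.
  rewrite !O3_dot // (P1 _ Pp) expr1n !mulr1 (dotC _ a).
  move=> /(_ (covering_cos_gt0 R) ltr01 ltr01 x1 a1 erefl ag pc).
  by rewrite ltNge aP //; apply: PG.
exists p0; split=> [|g Gg]; first exact: P1.
rewrite leNgt; apply/negP => pg; apply: no; exists (g^T *m p0).
  by apply: PG => //; apply: subgroup_tr.
by rewrite dotC -dot_mxE.
Qed.

(** * Poles of a rotation of least angle *)

Definition poles (R : realType) (G : set 'M[R]_3) (C S : R) : set 'cV[R]_3 :=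
  [set p | dot p p = 1 /\ G (quat_mx C (S *: p))].

(** The quaternions [(w, v)] and [(- w, - v)] give the same rotation, so bounding
    [w] bounds [|w|], and [C] is the cosine of half the least positive angle. *)
Definition extremal_rotation (R : realType) (G : set 'M[R]_3) (C S : R) :=
  [/\ 0 <= C, 0 < S, C ^+ 2 + S ^+ 2 = 1, poles G C S !=set0 &
    forall w v, w ^+ 2 + dot v v = 1 -> G (quat_mx w v) -> v = 0 \/ w <= C].

Lemma polesN (R : realType) (G : set 'M[R]_3) (C S : R) p :
  finite_subgroup_O3 G -> poles G C S p -> poles G C S (- p).
Proof.
move=> GG [p1 Gp]; split; first by rewrite !dot_linear opprK.
by rewrite scalerN -quat_mx_tr; apply: subgroup_tr.
Qed.

Lemma poles_invariant (R : realType) (G : set 'M[R]_3) (C S : R) g p :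
  finite_subgroup_O3 G -> G g -> poles G C S p -> poles G C S (g *m p).
Proof.
move=> GG Gg [p1 Gp].
have gO : O3 R g by case: GG => _ GO _ _ _; apply: GO.
have : G (g *m quat_mx C (S *: p) *m g^T).
  by case: (GG) => _ _ _ GM _; apply: (GM) => //; [apply: GM | apply: subgroup_tr].
rewrite quat_mx_conj // -scalemxAr => G1.
split; first by rewrite O3_dot.
case: (O3_det gO) G1 => ->; rewrite ?scale1r // scaleN1r -quat_mx_tr.
by move/(subgroup_tr GG); rewrite trmxK.
Qed.

(** The product of the rotations about [p] and [q], or about [p] and [- q], is the
    identity or has angle at least the least one; its real part is
    [C^2 - S^2 <p, q>]. *)
Lemma poles_angle (R : realType) (G : set 'M[R]_3) (C S : R) p q :
  finite_subgroup_O3 G -> extremal_rotation G C S -> poles G C S p -> poles G C S q ->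
  dot p q ^+ 2 = 1 \/ `|dot p q| * (1 + C) <= C.
Proof.
move=> GG [C0 S0 CS _ CM].
have half p' q' : poles G C S p' -> poles G C S q' ->
    dot p' q' ^+ 2 = 1 \/ - dot p' q' * (1 + C) <= C.
  move=> [p1 Gp] [q1 Gq].
  have Gpq : G (quat_mx C (S *: p') *m quat_mx C (S *: q')).
    by case: (GG) => _ _ _ GM _; apply: GM.
  move: Gpq; rewrite quat_mx_mul.
  have := quat_mul_norm C C (S *: p') (S *: q'); rewrite /=.
  move: (_ + cross _ _) => v''; rewrite !dotZl !dotZr p1 q1 !mulr1.
  rewrite -expr2 CS mulr1 => n1 /(CM _ _ n1).
  have u1 := unit_dot_le1 p1 q1.
  have C1 : 0 < 1 - C by nra.
  have SS : S * (S * dot p' q') = (1 - C ^+ 2) * dot p' q'.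
    by rewrite mulrA -expr2; congr (_ * _); lra.
  rewrite SS in n1 *.
  case=> [v0|h]; [left|right]; last by rewrite -(ler_pM2l C1); lra.
  move: n1; rewrite v0 dot0l addr0 => /eqP.
  rewrite sqrf_eq1 => /orP [] /eqP h.
    have /eqP : (1 - C) * ((1 + C) * (1 + dot p' q')) = 0 by lra.
    have C2 : 0 < 1 + C by lra.
    rewrite !mulf_eq0 (gt_eqF C1) (gt_eqF C2) /= addrC addr_eq0 => /eqP ->.
    by ring.
  have u1' : dot p' q' <= 1 by nra.
  have C00 : C = 0 by nra.
  by move: h; rewrite C00 => h; have -> : dot p' q' = 1; [lra | rewrite expr1n].
move=> Pp Pq; case: (half _ _ Pp Pq) => [|h1]; first by left.
case: (half _ _ Pp (polesN GG Pq)); rewrite dotNr ?sqrrN; first by left.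
by rewrite opprK => h2; right; case: (ger0P (dot p q)).
Qed.

Lemma finite_argmax (R : realType) (T : eqType) (A : set T) (f : T -> R) :
  finite_set A -> A !=set0 -> exists2 x, A x & forall y, A y -> f y <= f x.
Proof.
move=> /finite_seqP [s ->] {A}; elim: s => [|x s IH] [y]; first by rewrite /= in_nil.
move=> _; have [-> | s0] := eqVneq s [::].
  by exists x => [|z]; rewrite /= inE ?eqxx // => /eqP ->.
have [|m ms mM] := IH.
  by case: s s0 {IH} => // z s _; exists z; rewrite /= inE eqxx.
have [le|/ltW le] := lerP (f x) (f m).
  exists m => [|z] /=; rewrite inE ?(orbC (m == _)) ?[m \in s]ms ?orbT //.
  by case/orP=> [/eqP -> //|]; apply: mM.
exists x => [|z] /=; rewrite inE ?eqxx // => /orP [/eqP -> //|zs].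
exact: le_trans (mM _ zs) le.
Qed.

(** Least angle means largest trace, and traces range over a finite set. *)
Lemma exists_extremal_rotation (R : realType) (G : set 'M[R]_3) h :
  finite_subgroup_O3 G -> G h -> \det h = 1 -> h <> 1%:M ->
  exists C S, extremal_rotation G C S.
Proof.
move=> GG Gh h1 hn1; case: (GG) => Gfin GO _ _ _.
have [||g [Gg [g1 gn1]] gM] := @finite_argmax _ _
    [set g : 'M[R]_3 | G g /\ (\det g = 1 /\ g <> 1%:M)] mxtrace.
- by apply: sub_finite_set Gfin => g [].
- by exists h.
have [w [v [wv gE]]] := rotation_quat (GO _ Gg) g1.
have v0 : v != 0.
  apply/eqP => v0; apply: gn1; rewrite gE v0 quat_mx_1 //.
  by move: wv; rewrite v0 dot0l addr0.
wlog w0 : w v wv gE v0 / 0 <= w.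
  move=> H; case: (lerP 0 w) => [|/ltW w0]; first exact: (H w v).
  apply: (H (- w) (- v)); rewrite ?sqrrN ?quat_mxN ?oppr_eq0 ?oppr_ge0 //.
  by rewrite !dot_linear opprK.
have vv := dot_gt0 v0.
pose S := Num.sqrt (dot v v).
have S0 : 0 < S by rewrite sqrtr_gt0.
have SS : S ^+ 2 = dot v v by rewrite sqr_sqrtr // ltW.
exists w, S; split; rewrite ?SS //.
- exists (S^-1 *: v); split.
    by rewrite !dot_linear -SS; field; rewrite gt_eqF.
  by rewrite scalerA mulfV ?gt_eqF // scale1r -gE.
move=> w' v' wv' G'.
have [-> | v'0] := eqVneq v' 0; [by left|right].
have := gM (quat_mx w' v'); rewrite gE !quat_mx_trace => le.
have : 3 * w' ^+ 2 - dot v' v' <= 3 * w ^+ 2 - dot v v.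
  apply: le; split=> //; split; first by rewrite quat_mx_det wv' expr1n.
  by move=> /(quat_mx_eq1 wv') v'E; rewrite v'E eqxx in v'0.
by move=> ?; nra.
Qed.

(** Two orientation-reversing elements differ by a rotation, so here an orbit has
    at most two points, and a vector orthogonal to both is missed. *)
Lemma no_rotation_missed (R : realType) (G : set 'M[R]_3) x :
  finite_subgroup_O3 G -> (forall h, G h -> \det h = 1 -> h = 1%:M) -> missed G x.
Proof.
move=> GG H; case: (GG) => _ GO _ GM _.
have [[h Gh h1]|no] := pselect (exists2 h, G h & \det h = -1); last first.
  have [b [b1 bx _]] := exists_orthogonal_unit x x.
  exists b; split=> // g Gg; case: (O3_det (GO _ Gg)) => g1.
    by rewrite (H g) // mul1mx bx ltW // covering_cos_gt0.
  by case: no; exists g.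
have [b [b1 bx bhx]] := exists_orthogonal_unit x (h *m x).
exists b; split=> // g Gg; case: (O3_det (GO _ Gg)) => g1.
  by rewrite (H g) // mul1mx bx ltW // covering_cos_gt0.
have gh : g *m h^T = 1%:M.
  apply: H; first by apply: GM => //; apply: subgroup_tr.
  by rewrite det_mulmx det_tr g1 h1; ring.
have -> : g = h by rewrite -[g]mulmx1 -(O3_tr (GO _ Gh)) mulmxA gh mul1mx.
by rewrite bhx ltW // covering_cos_gt0.
Qed.

(** * Icosahedral configurations *)

Lemma dot_cross_r (R : realType) (u v : 'cV[R]_3) : dot v (cross u v) = 0.
Proof. by rewrite dotE !mxE /=; ring. Qed.

(** The expression assumed nonzero is the Gram determinant of [u], [v], [w], the
    square of their triple product. *)
Lemma orthogonal_basis_eq0 (R : realType) (n u v w : 'cV[R]_3) :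
  dot n u = 0 -> dot n v = 0 -> dot n w = 0 ->
  dot u u * (dot v v * dot w w - dot v w ^+ 2)
  - dot u v * (dot u v * dot w w - dot v w * dot u w)
  + dot u w * (dot u v * dot v w - dot v v * dot u w) != 0 -> n = 0.
Proof.
move=> nu nv nw gram; pose d := dot u (cross v w).
have dn : d *: n = dot n u *: cross v w + dot n v *: cross w u + dot n w *: cross u v.
  by rewrite /d !dotE; apply/colP; apply: ord3P; rewrite !mxE /=; ring.
have d2 : d ^+ 2 != 0.
  by apply: contraNneq gram => <-; apply/eqP; rewrite /d !dotE !mxE /=; ring.
move: dn; rewrite nu nv nw !scale0r !addr0 => /eqP.
by rewrite scaler_eq0 -(sqrf_eq0 d) (negbTE d2) => /eqP.
Qed.

Section Icosahedron.
Variable R : realType.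
Local Notation phi := (golden R).
Local Notation tau := (vertex_norm R).
Local Notation s3 := (Num.sqrt 3 : R).
Local Notation c := (covering_cos R).

(** Here [u], [u + v], [u + v + w] point to a vertex, an edge midpoint and a face
    centre of an icosahedron, and [golden], [vertex_norm] are the scale in which
    neighbouring vertices have inner product [golden].  The circumcentre [O] is a
    positive combination of the three corners, so a point closer than the
    circumradius to each corner would contradict Cauchy-Schwarz with [O]. *)
Lemma fundamental_triangle_radius (x u v w : 'cV[R]_3) :
  dot x x = 1 ->
  dot u u = 2 + phi -> dot v v = 2 + phi -> dot w w = 2 + phi ->
  dot u v = phi -> dot u w = phi -> dot v w = phi ->
  c * tau < dot x u -> c * (2 * phi) < dot x (u + v) ->
  c * (s3 * phi ^+ 2) < dot x (u + v + w) -> False.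
Proof.
move=> x1 uu vv ww uv uw vw xu xv xw.
have g2 := golden_sqr R; have t2 := vertex_norm_sqr R.
have s32 : s3 ^+ 2 = 3 by rewrite sqr_sqrtr.
have g_gt0 : 0 < phi by have /andP [? _] := golden_coarse R; lra.
have c_gt0 := covering_cos_gt0 R.
pose D := dot (circumcenter R) (circumcenter R).
have D_gt0 : 0 < D := circumcenter_norm_gt0 R.
have cD : c ^+ 2 * D = 1 by rewrite covering_cos_sqr mulVf // gt_eqF.
have g3 : phi ^+ 3 = 2 * phi + 1 by rewrite exprS g2 mulrDr -expr2 g2; ring.
(* The weights of [O] are forced by its inner products with the corners. *)
have [] := circumcenter_weights R; rewrite -g3.
set a := tau - phi; set d := s3 - phi => a_gt0 d_gt0 ad.
pose b := (1 - phi * a - phi ^+ 3 * d) / (2 * phi).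
have b_gt0 : 0 < b by apply: divr_gt0; lra.
have K : phi * a + 2 * phi * b + (2 * phi + 1) * d = 1.
  by rewrite -g3 /b; field; rewrite gt_eqF.
have DE : D = a * tau + b * (2 * phi) + d * (s3 * phi ^+ 2).
  rewrite /D vec3_dot; move: K; rewrite -g3 /a /d => K.
  have -> : b * (2 * phi) = 1 - phi * (tau - phi) - phi ^+ 3 * (s3 - phi) by lra.
  by ring.
pose O := a *: u + b *: (u + v) + d *: (u + v + w).
(* [K] multiplied by [golden] and reduced modulo its quadratic equation. *)
have g2M y : phi * (phi * y) = (phi + 1) * y by rewrite mulrA -expr2 g2.
have K2 : (phi + 1) * a + 2 * (phi + 1) * b + (3 * phi + 2) * d = phi.
  have : phi * (phi * a + 2 * phi * b + (2 * phi + 1) * d) = phi by rewrite K mulr1.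
  have := (g2M a, g2M b, g2M d) => -[[ga gb] gd]; lra.
have K3 : (2 * phi + 1) * a + 2 * (2 * phi + 1) * b + (5 * phi + 3) * d = phi + 1.
  have : phi * ((phi + 1) * a + 2 * (phi + 1) * b + (3 * phi + 2) * d) = phi + 1.
    by rewrite K2 -expr2.
  have := (g2M a, g2M b, g2M d) => -[[ga gb] gd]; lra.
have Ou : dot O u = tau.
  rewrite /O !dot_linear (dotC v u) (dotC w u) uu uv uw.
  by have aE : a = tau - phi by []; lra.
have Ouv : dot O (u + v) = 2 * phi.
  rewrite /O !dot_linear (dotC v u) (dotC w u) (dotC w v) uu uv uw vv vw; lra.
have Ouvw : dot O (u + v + w) = s3 * phi ^+ 2.
  rewrite g2 /O !dot_linear (dotC v u) (dotC w u) (dotC w v) uu uv uw vv vw ww.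
  have dE : (phi + 1) * d = s3 * (phi + 1) - (2 * phi + 1).
    by rewrite /d -[2 * phi + 1]g3 -g2; ring.
  lra.
have O_dot y : dot y O = a * dot y u + b * dot y (u + v) + d * dot y (u + v + w).
  by rewrite /O [LHS]dotDr [dot y (_ + _ *: _)]dotDr !dotZr.
have OO : dot O O = D by rewrite O_dot Ou Ouv Ouvw DE.
have xO : c * D < dot x O.
  by rewrite DE O_dot !mulrDr !ltrD // mulrCA ltr_pM2l.
have := cauchy_schwarz x O; rewrite x1 OO mul1r => le.
have : (c * D) ^+ 2 < dot x O ^+ 2.
  by rewrite ltr_pXn2r ?nnegrE // ?(le_trans _ (ltW xO)) // ltW // mulr_gt0.
have -> : (c * D) ^+ 2 = D by rewrite exprMn [D ^+ 2]expr2 mulrA cD mul1r.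
by rewrite ltNge le.
Qed.

(* [V] abstracts the poles of order five, scaled to norm [vertex_norm]. *)
Variable V : set 'cV[R]_3.
Hypothesis V_norm : forall v, V v -> dot v v = 2 + phi.
Hypothesis V_dot : forall v w, V v -> V w -> [\/ v = w, dot v w = phi | dot v w <= - phi].

Let V_le v w : V v -> V w -> v = w \/ dot v w <= phi.
Proof.
move=> Vv Vw; have /andP [? ?] := golden_coarse R.
by case: (V_dot Vv Vw) => [|->|h]; [left|right|right; lra].
Qed.

(** The vector [n] below is orthogonal to the basis [u], [v], [w], hence zero, but
    its inner product with [z] is positive. *)
Lemma no_four_equiangular u v w z : V u -> V v -> V w -> V z ->
  dot u v = phi -> dot u w = phi -> dot v w = phi ->
  dot z u = phi -> dot z v = phi -> dot z w = phi -> False.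
Proof.
move=> /V_norm uu /V_norm vv /V_norm ww /V_norm zz uv uw vw zu zv zw.
have /andP [g_lo g_hi] := golden_coarse R.
pose t := phi / (2 + 3 * phi).
have tE : t * (2 + 3 * phi) = phi by rewrite /t divfK // gt_eqF //; lra.
pose n := z - t *: (u + v + w).
have n0 : n = 0.
  apply: (@orthogonal_basis_eq0 _ n u v w);
    last by rewrite uu vv ww uv uw vw gt_eqF //; nra.
  - by rewrite /n !dot_linear (dotC v u) (dotC w u) uu uv uw zu; lra.
  - by rewrite /n !dot_linear (dotC w v) uv vv vw zv; lra.
  - by rewrite /n !dot_linear ww uw vw zw; lra.
have := congr1 (dot z) n0; rewrite (dotC z 0) dot0l /n !dot_linear zz zu zv zw.
have : t * phi < 1 by have : t < 1; nra.
lra.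
Qed.

(** A vertex, an edge and a face that are pairwise close are incident: each
    further inner product between poles is at most [golden], which is too small
    for closeness unless the vertex lies on the edge and the face, and the edge
    on the face.  This reduces to [fundamental_triangle_radius]. *)
Lemma icosahedral_triangle x u v v' w w' w'' : dot x x = 1 ->
  V u -> V v -> V v' -> V w -> V w' -> V w'' ->
  dot v v' = phi -> dot w w' = phi -> dot w w'' = phi -> dot w' w'' = phi ->
  c * tau < dot x u -> c * (2 * phi) < dot x (v + v') ->
  c * (s3 * phi ^+ 2) < dot x (w + w' + w'') -> False.
Proof.
move=> x1 Vu Vv Vv' Vw Vw' Vw'' vv ww1 ww2 ww3 xu xv xw.
have /andP [g_lo g_hi] := golden_coarse R; have t_lo := vertex_norm_gt R.
have s_lo := sqrt3_gt R; have g2 := golden_sqr R.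
have c0 := covering_cos_gt0 R; have c_lo := covering_cos_double_gt R.
have tau0 : 0 < tau by lra.
have g0 : 0 < 2 * phi by lra.
have sg0 : 22 / 5 < s3 * phi ^+ 2 by rewrite g2; nra.
have k0 : 3 / 4 < 2 * c ^+ 2 - 1 by lra.
have uu : dot u u = tau ^+ 2 by rewrite vertex_norm_sqr V_norm.
have vvn : dot (v + v') (v + v') = (2 * phi) ^+ 2.
  by rewrite !dot_linear (dotC v' v) vv !V_norm // exprMn g2; ring.
have wwn : dot (w + w' + w'') (w + w' + w'') = (s3 * phi ^+ 2) ^+ 2.
  rewrite !dot_linear (dotC w' w) (dotC w'' w) (dotC w'' w') ww1 ww2 ww3 !V_norm //.
  rewrite exprMn sqr_sqrtr // g2 expr2 mulrDr !mulrDl -expr2 g2; ring.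
have sg0' : 0 < s3 * phi ^+ 2 by lra.
wlog uw : w w' w'' Vw Vw' Vw'' ww1 ww2 ww3 xw wwn / u = w.
  move=> H.
  have := near_common_point c0 tau0 sg0' x1 uu wwn xu xw; rewrite !dotDr => near.
  have [E|l1] := V_le Vu Vw; first exact: (H w w' w'').
  have [E|l2] := V_le Vu Vw'.
    by apply: (H w' w w''); rewrite ?[w' + w]addrC // dotC.
  have [E|l3] := V_le Vu Vw''.
    have sumE : w'' + w + w' = w + w' + w'' by rewrite -addrA addrC.
    by apply: (H w'' w w'); rewrite ?sumE // dotC.
  have : 3 / 4 * (tau * (s3 * phi ^+ 2)) < 3 * phi by nra.
  nra.
subst w.
wlog uv : v v' Vv Vv' vv xv vvn / u = v.
  move=> H.
  have := near_common_point c0 tau0 g0 x1 uu vvn xu xv; rewrite !dotDr => near.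
  have [E|l1] := V_le Vu Vv; first exact: (H v v').
  have [E|l2] := V_le Vu Vv'.
    by apply: (H v' v); rewrite ?[v' + v]addrC // dotC.
  have : 3 / 4 * (tau * (2 * phi)) < 2 * phi by nra.
  nra.
subst v.
have near := near_common_point c0 g0 sg0' x1 vvn wwn xv xw.
have finish y z : V y -> V z -> dot u y = phi -> dot u z = phi -> dot y z = phi ->
    c * (2 * phi) < dot x (u + y) -> c * (s3 * phi ^+ 2) < dot x (u + y + z) -> False.
  move=> Vy Vz uy uz yz h1 h2.
  by apply: (fundamental_triangle_radius x1 _ _ _ uy uz yz xu h1 h2); apply: V_norm.
have [E|l1] := V_le Vv' Vw'; first by subst v'; apply: (finish w' w'').
have [E|l2] := V_le Vv' Vw''.
  subst v'; apply: (finish w'' w') => //; first by rewrite dotC.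
  by rewrite -addrA [w'' + _]addrC addrA.
move: near; rewrite !dot_linear (dotC v' u) vv ww1 ww2 (V_norm Vu) => near.
have dot_or y : V y -> dot v' y <= phi -> dot v' y = phi \/ dot v' y <= - phi.
  move=> Vy l; case: (V_dot Vv' Vy) => [E|e|e]; [|by left|by right].
  by subst v'; move: l; rewrite V_norm //; lra.
have [[e1 e2]|le] : dot v' w' = phi /\ dot v' w'' = phi \/ dot v' w' + dot v' w'' <= 0.
- by case: (dot_or _ Vw' l1) (dot_or _ Vw'' l2) => e1 [] e2; [left|right|right|right]; lra.
- by apply: (@no_four_equiangular u w' w'' v'); rewrite ?(dotC v' u).
have : 3 / 4 * (2 * phi * (s3 * phi ^+ 2)) < 2 + 4 * phi by nra.
nra.
Qed.

(** If no direction were missed, some translates of the given vertex, edge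
    midpoint and face centre would all be close to [x]. *)
Lemma icosahedral_missed (G : set 'M[R]_3) x u v w :
  finite_subgroup_O3 G -> dot x x = 1 -> (forall g p, G g -> V p -> V (g *m p)) ->
  V u -> V v -> V w -> dot u v = phi -> dot u w = phi -> dot v w = phi -> missed G x.
Proof.
move=> GG x1 VG Vu Vv Vw uv uw vw.
have /andP [g_lo g_hi] := golden_coarse R; have t_lo := vertex_norm_gt R.
have s_lo := sqrt3_gt R; have g2 := golden_sqr R.
apply: contrapT => no.
have near b n : 0 < n -> dot b b = n ^+ 2 ->
    exists g, [/\ G g^T, O3 R g & c * n < dot x (g *m b)].
  move=> n0 bn; apply: contrapT => nog; apply: no; exists (n^-1 *: b); split.
    by rewrite !dot_linear bn; field; rewrite gt_eqF.
  move=> g Gg; rewrite leNgt; apply/negP => gc; apply: nog; exists g^T.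
  have GgT := subgroup_tr GG Gg.
  split; rewrite ?trmxK //; first by case: GG => _ GO _ _ _; apply: GO.
  by rewrite dotC -dot_mxE -(ltr_pM2l (_ : 0 < n^-1)) ?invr_gt0 // -dotZl;
    rewrite mulrC mulfK ?gt_eqF.
have Vg g p : G g^T -> V p -> V (g *m p).
  by move=> /(subgroup_tr GG); rewrite trmxK; apply: VG.
have [|//|g1 [G1 O1 x_1]] := near u tau; [lra | by rewrite V_norm // vertex_norm_sqr |].
have [|//|g2' [G2 O2 x_2]] := near (u + v) (2 * phi); [lra | |].
  by rewrite !dot_linear (dotC v u) uv !V_norm // exprMn g2; ring.
have [|//|g3 [G3 O3' x_3]] := near (u + v + w) (s3 * phi ^+ 2); [by rewrite g2; nra | |].
  rewrite !dot_linear (dotC v u) (dotC w u) (dotC w v) uv uw vw !V_norm //.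
  by rewrite exprMn sqr_sqrtr // g2 expr2 mulrDr !mulrDl -expr2 g2; ring.
rewrite !mulmxDr in x_2 x_3.
apply: (icosahedral_triangle x1 _ _ _ _ _ _ _ _ _ _ x_1 x_2 x_3);
  rewrite ?O3_dot //; exact: Vg.
Qed.

End Icosahedron.

(** * Missed directions for every finite group *)

Lemma unit_parallel (R : realType) (p q : 'cV[R]_3) :
  dot p p = 1 -> dot q q = 1 -> dot p q ^+ 2 = 1 -> q = dot p q *: p.
Proof.
move=> p1 q1 u; apply/eqP; rewrite -subr_eq0; apply/eqP; apply: dot_eq0.
by rewrite !dot_linear (dotC q p) p1 q1; lra.
Qed.

Lemma dot_quat_mx (R : realType) w (v a : 'cV[R]_3) :
  dot a (quat_mx w v *m a) = (w ^+ 2 - dot v v) * dot a a + 2 * dot v a ^+ 2.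
Proof.
rewrite quat_mx_vec !dotDr !dotZr dot_cross_r (dotC a v); ring.
Qed.

Lemma quat_mx_fix (R : realType) w s (p : 'cV[R]_3) :
  w ^+ 2 + s ^+ 2 = 1 -> dot p p = 1 -> quat_mx w (s *: p) *m p = p.
Proof.
move=> ws p1; rewrite quat_mx_vec !dot_linear p1 !mulr1.
have -> : cross (s *: p) p = 0.
  by apply/colP; apply: ord3P; rewrite !mxE /=; ring.
rewrite scaler0 addr0 scalerA -scalerDl -[RHS]scale1r; congr (_ *: _); lra.
Qed.

Section Extremal.
Variables (R : realType) (G : set 'M[R]_3) (C S : R).
Hypothesis GG : finite_subgroup_O3 G.
Hypothesis ext : extremal_rotation G C S.

(** With [A] the rotation about [p], [poles_angle] bounds [<q, A q>] from above and
    [<q, A^2 q>] from below, both affine in [U = <p, q>^2].  Eliminating [U] between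
    them gives [4 C^2 - 2 C - 1 <= 0]; combining the second with the bound on [U]
    itself gives the opposite inequality.  The threshold [5/7] only has to exceed
    [sqrt 2 / 2], which excludes [A^2 q = - q]. *)
Lemma extremal_icosahedral p q : 5 / 7 < C ->
  poles G C S p -> poles G C S q -> dot p q ^+ 2 != 1 ->
  4 * C ^+ 2 = 2 * C + 1 /\ 5 * dot p q ^+ 2 = 1.
Proof.
move=> C57 Pp Pq u1; have [C0 S0 CS _ _] := ext.
have C1 : 0 < 1 - C by nra.
have [p1 Gp] := Pp; have [q1 Gq] := Pq.
pose A := quat_mx C (S *: p).
have PA r : poles G C S r -> poles G C S (A *m r) by apply: poles_invariant.
have SS : S ^+ 2 = 1 - C ^+ 2 by lra.
set U := dot p q ^+ 2 in u1 *.
have qAq : dot q (A *m q) = 2 * C ^+ 2 - 1 + 2 * (1 - C ^+ 2) * U.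
  rewrite dot_quat_mx !dotZl !dotZr p1 q1 !mulr1 exprMn -expr2 SS /U; ring.
have qAAq : dot q (A *m (A *m q)) =
    2 * (2 * C ^+ 2 - 1) ^+ 2 - 1 + 8 * C ^+ 2 * (1 - C ^+ 2) * U.
  rewrite mulmxA quat_mx_mul.
  have -> : C *: (S *: p) + C *: (S *: p) + cross (S *: p) (S *: p) = (2 * C * S) *: p.
    by apply/colP; apply: ord3P; rewrite !mxE /=; ring.
  rewrite dot_quat_mx !dotZl !dotZr p1 q1 !mulr1 /U.
  have E : (C ^+ 2 + S ^+ 2) ^+ 2 = 1 by rewrite CS expr1n.
  have -> : 2 * C ^+ 2 - 1 = C ^+ 2 - S ^+ 2 by lra.
  by have -> : 1 - C ^+ 2 = S ^+ 2 by []; lra.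
have U0 : 0 <= U by apply: sqr_ge0.
have U1 : U < 1 by rewrite lt_neqAle u1 unit_dot_le1.
have bU : U * (1 + C) ^+ 2 <= C ^+ 2.
  case: (poles_angle GG ext Pp Pq) => [E|]; first by rewrite /U E eqxx in u1.
  move=> le; rewrite /U -[dot p q ^+ 2]real_normK ?num_real // -exprMn.
  by apply: lerXn2r; rewrite ?nnegrE // mulr_ge0 // addr_ge0.
have b1 : (2 * C ^+ 2 - 1 + 2 * (1 - C ^+ 2) * U) * (1 + C) <= C.
  have := poles_angle GG ext Pq (PA _ Pq); rewrite qAq => -[/eqP|le].
    rewrite sqrf_eq1 => /orP [] /eqP; nra.
  by apply: le_trans le; rewrite ler_wpM2r ?ler_norm //; lra.
have b2 : - (2 * (2 * C ^+ 2 - 1) ^+ 2 - 1 + 8 * C ^+ 2 * (1 - C ^+ 2) * U) * (1 + C) <= C.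
  have := poles_angle GG ext Pq (PA _ (PA _ Pq)); rewrite qAAq => -[/eqP|le].
    have W0 : 0 < 4 * C ^+ 2 * (1 - C ^+ 2) by rewrite mulr_gt0 //; nra.
    have WU0 : 0 <= 4 * C ^+ 2 * (1 - C ^+ 2) * U by rewrite mulr_ge0 // ltW.
    have WU1 : 0 < 4 * C ^+ 2 * (1 - C ^+ 2) * (1 - U) by rewrite mulr_gt0 // subr_gt0.
    have k0 : 0 < (2 * C ^+ 2 - 1) ^+ 2 by rewrite exprn_gt0 //; nra.
    rewrite sqrf_eq1 => /orP [] /eqP; lra.
  by apply: le_trans le; apply: ler_wpM2r; [lra | rewrite -normrN ler_norm].
have CC0 : 0 < 4 * C ^+ 2 by nra.
(* Upper bound on [C]: eliminate [U] between [b1] and [b2]. *)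
have X1 : 4 * C ^+ 2 - 2 * C - 1 <= 0.
  have : 4 * C ^+ 2 * ((2 * C ^+ 2 - 1 + 2 * (1 - C ^+ 2) * U) * (1 + C)) <= 4 * C ^+ 2 * C.
    by rewrite ler_pM2l.
  lra.
(* Lower bound on [C]: eliminate [U] between [b2] and [bU]. *)
have X2 : 0 <= 4 * C ^+ 2 - 2 * C - 1.
  have h1 : 0 <= 8 * C ^+ 2 * (1 - C ^+ 2) by nra.
  have h2 : 8 * C ^+ 2 * (1 - C ^+ 2) * (U * (1 + C) ^+ 2) <= 8 * C ^+ 2 * (1 - C ^+ 2) * C ^+ 2.
    by rewrite ler_wpM2l.
  have h3 : - (2 * (2 * C ^+ 2 - 1) ^+ 2 - 1 + 8 * C ^+ 2 * (1 - C ^+ 2) * U) * (1 + C) * (1 + C)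
     <= C * (1 + C) by rewrite ler_wpM2r //; lra.
  have h4 : 0 <= ((1 + C) * (4 * C ^+ 2 - 1)) * (4 * C ^+ 2 - 2 * C - 1) by lra.
  have h5 : 0 < (1 + C) * (4 * C ^+ 2 - 1) by rewrite mulr_gt0 //; nra.
  by rewrite -(pmulr_rge0 _ h5).
have X : 4 * C ^+ 2 = 2 * C + 1 by lra.
split=> //.
(* Reduce the powers of [C] modulo [X]; then [b1] and [b2] pinch [U]. *)
have X3 : C ^+ 3 = C / 2 + 1 / 8 by rewrite exprS; nra.
have X4 : C ^+ 4 = 3 / 8 * C + 1 / 8 by rewrite exprS X3; nra.
have X5 : C ^+ 5 = 5 / 16 * C + 3 / 32 by rewrite exprS X4; nra.
have hU : 5 * U <= 1.
  have : C ^+ 2 * U = (2 * C + 1) / 4 * U by congr (_ * _); lra.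
  have : C ^+ 3 * U = (C / 2 + 1 / 8) * U by rewrite X3.
  move: b1; lra.
have lU : (5 * U - 1) * C ^+ 2 >= 0.
  have E2 : C ^+ 2 * U = (2 * C + 1) / 4 * U by congr (_ * _); lra.
  have E3 : C ^+ 3 * U = (C / 2 + 1 / 8) * U by rewrite X3.
  have E4 : C ^+ 4 * U = (3 / 8 * C + 1 / 8) * U by rewrite X4.
  have E5 : C ^+ 5 * U = (5 / 16 * C + 3 / 32) * U by rewrite X5.
  move: b2; lra.
have : 0 <= 5 * U - 1 by rewrite -(pmulr_lge0 _ (_ : 0 < C ^+ 2)) // exprn_gt0; lra.
lra.
Qed.

Lemma extremal_missed x : dot x x = 1 -> missed G x.
Proof.
move=> x1; have [C0 S0 CS [p Pp] _] := ext.
have Pinv g r : G g -> poles G C S r -> poles G C S (g *m r) by apply: poles_invariant.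
have P1 r : poles G C S r -> dot r r = 1 by case.
have k_gt := covering_cos_double_gt R; have p1 := P1 _ Pp.
have [[q [Pq u1]]|single] := pselect (exists q, poles G C S q /\ dot p q ^+ 2 != 1); last first.
  have [a [a1 ap _]] := exists_orthogonal_unit p p.
  apply: (invariant_set_missed GG x1 Pinv P1 Pp a1) => q Pq.
  have -> : q = dot p q *: p.
    apply: unit_parallel; rewrite ?P1 //; apply/eqP/negPn/negP => u1.
    by apply: single; exists q.
  by rewrite dotZr ap mulr0; lra.
wlog u0 : q Pq u1 / 0 <= dot p q.
  move=> H; case: (lerP 0 (dot p q)) => [|/ltW u0]; first exact: (H q).
  apply: (H (- q)); rewrite ?dotNr ?sqrrN ?oppr_ge0 //; exact: polesN.
have q1 := P1 _ Pq.
(* [5 / 12] is the value of [C / (1 + C)] at [C = 5 / 7]. *)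
case: (lerP C (5 / 7)) => C57.
  have t_bound r s : poles G C S r -> poles G C S s -> dot r s ^+ 2 = 1 \/ `|dot r s| <= 5 / 12.
    move=> Pr Ps; case: (poles_angle GG ext Pr Ps) => h; [by left|right].
    have : 0 <= `|dot r s| by [].
    by move: (`|_|) h => t h t0; nra.
  have u_le : dot p q <= 5 / 12.
    case: (t_bound _ _ Pp Pq) => [E|]; first by rewrite E eqxx in u1.
    by apply: le_trans; apply: ler_norm.
  pose n := Num.sqrt (2 - 2 * dot p q).
  have nn : n ^+ 2 = 2 - 2 * dot p q by rewrite sqr_sqrtr //; lra.
  have n0 : 0 < n by rewrite sqrtr_gt0; lra.
  pose a := n^-1 *: (p - q).
  have a1 : dot a a = 1.
    rewrite /a !dot_linear (dotC q p) p1 q1 -/n.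
    apply: (mulfI (_ : n ^+ 2 != 0)); first by rewrite sqrf_eq0 gt_eqF.
    by rewrite {1}nn; field: nn; rewrite gt_eqF.
  apply: (invariant_set_missed GG x1 Pinv P1 Pp a1) => r Pr.
  have r1 := P1 _ Pr.
  suff : (dot p r - dot q r) ^+ 2 <= (79 / 100 * n) ^+ 2.
    move=> h; rewrite /a dotZl dotDl dotNl -(ler_pM2l n0) mulrA mulfV ?gt_eqF // mul1r.
    apply: (@le_trans _ _ (79 / 100 * n)); last by rewrite mulrC ler_pM2l // ltW.
    rewrite leNgt; apply/negP => lt.
    have : (79 / 100 * n) ^+ 2 < (dot p r - dot q r) ^+ 2.
      by rewrite ltr_pXn2r ?nnegrE //; lra.
    by rewrite ltNge h.
  rewrite exprMn nn.
  case: (t_bound _ _ Pp Pr) => [e|h1].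
    rewrite [r](unit_parallel p1 r1 e) !dotZr p1 (dotC q p) -mulrBr exprMn e; nra.
  case: (t_bound _ _ Pq Pr) => [e|h2].
    rewrite [r](unit_parallel q1 r1 e) !dotZr q1 -mulrBr exprMn e; nra.
  move: h1 h2; rewrite !ler_norml => /andP [a1' a2] /andP [a3 a4]; nra.
have [X u5] := extremal_icosahedral C57 Pp Pq u1.
have g2 := golden_sqr R; have /andP [g_lo g_hi] := golden_coarse R.
have t2 := vertex_norm_sqr R; have t_lo := vertex_norm_gt R.
(* Icosahedral case: a third vertex [A q] completes a face with [p] and [q]. *)
have CE : 2 * C = golden R.
  have /eqP : (2 * C - golden R) * (2 * C + golden R - 1) = 0 by lra.
  by rewrite mulf_eq0 => /orP [] /eqP; lra.
have m_of u : 5 * u ^+ 2 = 1 -> 0 <= u -> (2 + golden R) * u = golden R.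
  move=> u5' u0'.
  have /eqP : ((2 + golden R) * u - golden R) * ((2 + golden R) * u + golden R) = 0.
    have sq : (2 + golden R) ^+ 2 = 5 * (golden R + 1) by lra.
    have -> : ((2 + golden R) * u - golden R) * ((2 + golden R) * u + golden R) =
      (2 + golden R) ^+ 2 * u ^+ 2 - golden R ^+ 2 by ring.
    by rewrite sq g2 mulrAC u5'; ring.
  by rewrite mulf_eq0 => /orP [] /eqP; nra.
have um := m_of _ u5 u0.
pose V := [set vertex_norm R *: r | r in poles G C S].
pose A := quat_mx C (S *: p).
have PA : poles G C S (A *m q) by apply: poles_invariant => //; case: Pp.
have VD r s : dot (vertex_norm R *: r) (vertex_norm R *: s) = (2 + golden R) * dot r s.
  by rewrite dotZl dotZr mulrA -expr2 t2.
have SS : S ^+ 2 = 1 - C ^+ 2 by lra.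
apply: (@icosahedral_missed R V _ _ G x (vertex_norm R *: p) (vertex_norm R *: q)
  (vertex_norm R *: (A *m q))) => //.
- by move=> _ [r Pr <-]; rewrite VD P1 // mulr1.
- move=> _ _ [r Pr <-] [s Ps <-]; rewrite VD.
  have [e|ne] := eqVneq (dot r s ^+ 2) 1.
    rewrite (unit_parallel (P1 _ Pr) (P1 _ Ps) e).
    move/eqP: (e); rewrite sqrf_eq1 => /orP [] /eqP ->.
      by apply: Or31; rewrite scale1r.
    by apply: Or33; rewrite dotZr P1 //; lra.
  have [_ w5] := extremal_icosahedral C57 Pr Ps ne.
  case: (lerP 0 (dot r s)) => [w0|/ltW w0]; first by apply: Or32; apply: m_of.
  apply: Or33; have := m_of (- dot r s); rewrite sqrrN oppr_ge0 => /(_ w5 w0); lra.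
- by move=> g _ Gg [r Pr <-]; exists (g *m r); rewrite -?scalemxAr //; apply: Pinv.
- by exists p.
- by exists q.
- by exists (A *m q).
- by rewrite VD.
- rewrite VD -{1}(quat_mx_fix CS p1) -/A O3_dot //.
  by case: Pp => _; case: GG => _ GO _ _ _; apply: GO.
- have k2 : 2 * C ^+ 2 - 1 + 2 * (1 - C ^+ 2) * dot p q ^+ 2 = dot p q.
    have C2 : (2 * C) ^+ 2 = golden R + 1 by rewrite CE.
    have -> : dot p q ^+ 2 = 1 / 5 by lra.
    have -> : dot p q = (2 * golden R - 1) / 5.
      have g3 : 2 + golden R != 0 by rewrite gt_eqF //; lra.
      by apply: (mulfI g3); rewrite um; lra.
    have -> : 2 * C ^+ 2 = (golden R + 1) / 2 by lra.
    have -> : 2 * (1 - C ^+ 2) = (3 - golden R) / 2 by lra.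
    lra.
  rewrite VD dot_quat_mx !dotZl !dotZr p1 q1 !mulr1 exprMn -expr2 SS.
  have -> : C ^+ 2 - (1 - C ^+ 2) + 2 * ((1 - C ^+ 2) * dot p q ^+ 2) = dot p q by lra.
  exact: um.
Qed.

End Extremal.

Lemma orbit_missed (R : realType) (G : set 'M[R]_3) (x : 'cV[R]_3) :
  finite_subgroup_O3 G ->
  exists b, dot b b = 1 /\ forall g, G g -> dot b (g *m x) <= covering_cos R * enorm x.
Proof.
move=> GG; have c0 := covering_cos_gt0 R.
have [->|x0] := eqVneq x 0.
  have [b [b1 _ _]] := exists_orthogonal_unit (0 : 'cV[R]_3) 0.
  by exists b; split=> // g _; rewrite mulmx0 dotC dot0l mulr_ge0 ?sqrtr_ge0 // ltW.
have n0 : 0 < enorm x by rewrite enormE sqrtr_gt0 dot_gt0.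
have nn : enorm x ^+ 2 = dot x x by rewrite enormE sqr_sqrtr ?dot_ge0.
have y1 : dot ((enorm x)^-1 *: x) ((enorm x)^-1 *: x) = 1.
  by rewrite !dot_linear -nn; field; rewrite gt_eqF.
have [b [b1 bG]] : missed G ((enorm x)^-1 *: x).
  have [[h [Gh [h1 hn1]]]|no] := pselect (exists h, G h /\ \det h = 1 /\ h <> 1%:M).
    by have [C [S ext]] := exists_extremal_rotation GG Gh h1 hn1;
      apply: extremal_missed ext _ y1.
  apply: no_rotation_missed => // h Gh h1; apply: contrapT => hn1.
  by apply: no; exists h.
exists b; split=> // g Gg; have := bG g Gg.
by rewrite -scalemxAr dotZr -(ler_pM2l n0) mulrA mulfV ?gt_eqF // mul1r mulrC.
Qed.

(** * Hausdorff distance between an orbit and the sphere *)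

Lemma edistance_unit (R : realType) (b y : 'cV[R]_3) : dot b b = 1 ->
  edistance b y = Num.sqrt (1 - 2 * dot b y + dot y y).
Proof.
by move=> b1; rewrite /edistance enormE !dot_linear (dotC y b) b1; congr Num.sqrt; ring.
Qed.

Lemma edistance_ge0 (R : realType) (a b : 'cV[R]_3) : 0 <= edistance a b.
Proof. exact: sqrtr_ge0. Qed.

Lemma edistanceC (R : realType) (a b : 'cV[R]_3) : edistance a b = edistance b a.
Proof. by rewrite /edistance !enormE -(opprB b a) dotNl dotNr opprK. Qed.

Lemma dist_to_set_le (R : realType) (a b : 'cV[R]_3) (B : set 'cV[R]_3) :
  B b -> dist_to_set a B <= edistance a b.
Proof.
move=> Bb; apply: ge_inf; last by exists b.
by exists 0 => _ [y _ <-]; apply: edistance_ge0.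
Qed.

Lemma unit_sphereP (R : realType) (b : 'cV[R]_3) : unit_sphere R b <-> dot b b = 1.
Proof.
rewrite /unit_sphere /= enormE; split=> [b1|->]; last exact: sqrtr1.
by rewrite -[LHS]sqr_sqrtr ?dot_ge0 // b1 expr1n.
Qed.

Definition covering_sin (R : realType) : R := Num.sqrt (1 - covering_cos R ^+ 2).

Lemma sphere_dist_bounded (R : realType) (B : set 'cV[R]_3) x : B x ->
  has_ubound [set dist_to_set b B | b in unit_sphere R].
Proof.
move=> Bx; exists (Num.sqrt (2 + 2 * dot x x)) => _ [b /unit_sphereP b1 <-].
apply: le_trans (dist_to_set_le _ Bx) _; rewrite edistance_unit // ler_wsqrtr //.
have := dot_ge0 (b + x); rewrite !dot_linear b1 (dotC x b); lra.
Qed.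

Lemma hausdorff_distance_orbit_ge (R : realType) (X : set 'cV[R]_3) :
  finite_homogeneous X -> covering_sin R <= hausdorff_distance X (unit_sphere R).
Proof.
move=> [G [x [GG ->]]]; have [b [b1 bG]] := orbit_missed x GG.
have [Gfin GO G1 _ _] := GG.
have Xx : orbit3 G x x by exists 1%:M => //; rewrite mul1mx.
rewrite /hausdorff_distance le_max; apply/orP; right.
have bS : unit_sphere R b by apply/unit_sphereP.
apply: (@le_trans _ _ (dist_to_set b (orbit3 G x))); last first.
  by apply: ub_le_sup; [apply: sphere_dist_bounded Xx | exists b].
apply: lb_le_inf; first by exists (edistance b x); exists x.
move=> _ [_ [g Gg <-] <-]; rewrite edistance_unit // ler_wsqrtr // O3_dot; last exact: GO.
have nn : enorm x ^+ 2 = dot x x by rewrite enormE sqr_sqrtr ?dot_ge0.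
have := bG g Gg; have := sqr_ge0 (enorm x - covering_cos R); rewrite -nn; lra.
Qed.

(** The covering hypothesis says that some [g o] is within the covering angle of
    [b].  The radius [c^2 |o| = c] of the orbit minimizes the distance
    [1 - 2 r c + r^2] for that angle. *)
Lemma hausdorff_distance_orbit_le (R : realType) (G : set 'M[R]_3) (o : 'cV[R]_3) :
  finite_subgroup_O3 G -> dot o o = dot (circumcenter R) (circumcenter R) ->
  (forall b, dot b b = 1 -> exists2 g, G g & 1 <= dot b (g *m o)) ->
  hausdorff_distance (orbit3 G (covering_cos R ^+ 2 *: o)) (unit_sphere R) <= covering_sin R.
Proof.
move=> GG oo cover; have [_ GO G1 _ _] := GG.
have c0 := covering_cos_gt0 R; have D0 := circumcenter_norm_gt0 R.
have c1 : covering_cos R <= 1.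
  by have /andP [_ h] := covering_cos_sqr_bounds R;
    rewrite -(ler_pXn2r (n := 2)) ?nnegrE ?ltW //; lra.
have oo2 : dot o o * covering_cos R ^+ 2 = 1.
  by rewrite covering_cos_sqr oo mulfV // gt_eqF.
set x := _ *: o.
have Xx : orbit3 G x x by exists 1%:M => //; rewrite mul1mx.
rewrite /hausdorff_distance ge_max; apply/andP; split.
- apply: ge_sup; first by exists (dist_to_set x (unit_sphere R)); exists x.
  move=> _ [_ [g Gg <-] <-]; have gO := GO _ Gg.
  have b1 : dot (covering_cos R *: (g *m o)) (covering_cos R *: (g *m o)) = 1.
    by rewrite dotZl dotZr O3_dot // mulrA -expr2 mulrC.
  apply: le_trans (dist_to_set_le _ _) _; first by apply/unit_sphereP; exact: b1.
  rewrite edistanceC edistance_unit // ler_wsqrtr // /x -scalemxAr !dotZl !dotZr O3_dot //.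
  have -> : covering_cos R * (covering_cos R ^+ 2 * dot o o) = covering_cos R.
    by rewrite [_ ^+ 2 * _]mulrC oo2 mulr1.
  rewrite [covering_cos R ^+ 2 * dot o o]mulrC oo2 mulr1; nra.
apply: ge_sup.
  have [b [b1 _ _]] := exists_orthogonal_unit x x.
  by exists (dist_to_set b (orbit3 G x)); exists b => //; apply/unit_sphereP.
move=> _ [b /unit_sphereP b1 <-]; have [g Gg bg] := cover b b1.
apply: le_trans (dist_to_set_le _ _) _; first by exists g; [exact: Gg|reflexivity].
rewrite edistance_unit // ler_wsqrtr // O3_dot; last exact: GO.
rewrite /x -scalemxAr !dotZl !dotZr [covering_cos R ^+ 2 * dot o o]mulrC oo2.
have : 0 < covering_cos R ^+ 2 by rewrite exprn_gt0.
nra.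
Qed.

(** * The icosahedral group *)

Section IcosahedralGroup.
Variable R : realType.
Local Notation phi := (golden R).
Local Notation tau := (vertex_norm R).
Local Notation s3 := (Num.sqrt 3 : R).

Definition icosahedron : seq 'cV[R]_3 :=
  [:: vec3 0 1 phi; vec3 0 1 (- phi); vec3 0 (- 1) phi; vec3 0 (- 1) (- phi);
      vec3 1 phi 0; vec3 1 (- phi) 0; vec3 (- 1) phi 0; vec3 (- 1) (- phi) 0;
      vec3 phi 0 1; vec3 (- phi) 0 1; vec3 phi 0 (- 1); vec3 (- phi) 0 (- 1)].

(** Defined as a stabilizer, so that the group axioms are immediate and only
    finiteness and the required reflections need the coordinates. *)
Definition icosahedral_group : set 'M[R]_3 :=
  [set g | O3 R g /\ forall v, (g *m v \in icosahedron) = (v \in icosahedron)].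

(** An element is determined by the images of three independent vertices. *)
Lemma icosahedral_group_finite : finite_set icosahedral_group.
Proof.
pose v0 := vec3 0 1 phi; pose v1 := vec3 1 phi 0; pose v2 := vec3 phi 0 1.
pose cols (u v w : 'cV[R]_3) := mat3 (u i0 0) (v i0 0) (w i0 0)
  (u i1 0) (v i1 0) (w i1 0) (u i2 0) (v i2 0) (w i2 0).
have cols_mul (g : 'M[R]_3) u v w : cols (g *m u) (g *m v) (g *m w) = g *m cols u v w.
  by rewrite (mat3_eta g) mat3_mul /cols !mxE !big3 !mxE.
pose B := cols v0 v1 v2.
have Bu : B \in unitmx.
  have /andP [g_lo g_hi] := golden_coarse R.
  rewrite unitmxE unitfE /B /cols !mxE /= mat3_det.
  have -> : 0 * (phi * 1 - 0 * 0) - 1 * (1 * 1 - 0 * phi) + phi * (1 * 0 - phi * phi) =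
    - (1 + phi ^+ 3) by ring.
  by rewrite oppr_eq0 gt_eqF // addr_gt0 // exprn_gt0; lra.
pose A := [set` icosahedron].
have finA : finite_set A by apply: finite_seq.
pose f (t : 'cV[R]_3 * 'cV[R]_3 * 'cV[R]_3) := cols t.1.1 t.1.2 t.2 *m invmx B.
apply: (@sub_finite_set _ _ (f @` ((A `*` A) `*` A))).
  move=> g [gO gV]; exists (g *m v0, g *m v1, g *m v2).
    by split; [split|]; rewrite /A /= gV !inE eqxx ?orbT.
  by rewrite /f /= cols_mul mulmxK.
exact: finite_image (finite_setX (finite_setX finA finA) finA).
Qed.

Lemma icosahedral_group_subgroup : finite_subgroup_O3 icosahedral_group.
Proof.
split.
- exact: icosahedral_group_finite.
- by move=> g [].
- by split=> [v|v]; rewrite mul1mx.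
- move=> g h [gO gV] [hO hV]; split=> [v|v]; first by rewrite -mulmxA gO hO.
  by rewrite -mulmxA gV hV.
- move=> g [gO gV]; rewrite O3_invmx //.
  have gT v : g *m (g^T *m v) = v by rewrite mulmxA O3_trC // mul1mx.
  by split=> [v|v]; [rewrite -gO gT | rewrite -gV gT].
Qed.

(** The list [p] gives the permutation of the vertices induced by [g]. *)
Lemma involution_icosahedral (g : 'M[R]_3) (p : seq nat) :
  g^T = g -> g *m g = 1%:M -> all (fun j => j < 12)%N p ->
  [seq g *m v | v <- icosahedron] = [seq nth 0 icosahedron j | j <- p] ->
  icosahedral_group g.
Proof.
move=> gT gg p12 gp.
have gV v : v \in icosahedron -> g *m v \in icosahedron.
  move=> /(map_f (mulmx g)); rewrite gp => /mapP [j jp ->].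
  by rewrite mem_nth //; have /allP := p12; apply.
split; first by apply: O3_of_tr; rewrite gT.
move=> v; apply/idP/idP; last exact: gV.
by move/gV; rewrite mulmxA gg mul1mx.
Qed.

Definition mirror_x : 'M[R]_3 := mat3 (- 1) 0 0 0 1 0 0 0 1.
Definition mirror_y : 'M[R]_3 := mat3 1 0 0 0 (- 1) 0 0 0 1.
(** The reflection in the plane through the vertex [(0, 1, golden)] and the face
    centre [(1, 0, golden^2)], with unit normal [(- golden, - 1, golden - 1) / 2]. *)
Definition mirror_oblique : 'M[R]_3 :=
  mat3 ((1 - phi) / 2) (- phi / 2) (1 / 2)
       (- phi / 2) (1 / 2) ((phi - 1) / 2)
       (1 / 2) ((phi - 1) / 2) (phi / 2).

Lemma mirror_x_icosahedral : icosahedral_group mirror_x.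
Proof.
apply: (@involution_icosahedral _ [:: 0; 1; 2; 3; 6; 7; 4; 5; 9; 8; 11; 10]%N) => //.
- by rewrite mat3_tr.
- by rewrite mat3_mul mat3_1; congr mat3; ring.
- by rewrite /= /mirror_x !mat3_vec; do ![congr cons]; congr vec3; ring.
Qed.

Lemma mirror_y_icosahedral : icosahedral_group mirror_y.
Proof.
apply: (@involution_icosahedral _ [:: 2; 3; 0; 1; 5; 4; 7; 6; 8; 9; 10; 11]%N) => //.
- by rewrite mat3_tr.
- by rewrite mat3_mul mat3_1; congr mat3; ring.
- by rewrite /= /mirror_y !mat3_vec; do ![congr cons]; congr vec3; ring.
Qed.

Lemma mirror_oblique_icosahedral : icosahedral_group mirror_oblique.
Proof.
have g2 := golden_sqr R.
apply: (@involution_icosahedral _ [:: 0; 11; 8; 3; 9; 5; 6; 10; 2; 4; 7; 1]%N) => //.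
- by rewrite mat3_tr.
- by rewrite mat3_mul mat3_1; congr mat3; lra.
- by rewrite /= /mirror_oblique !mat3_vec; do ![congr cons]; congr vec3; lra.
Qed.

(** The three inequalities place [y] on the same side of the walls as the
    circumcentre, that is, [y = h (0, 0, 1) + y1 (0, 1, golden) + y0 (1, 0, golden^2)]
    with nonnegative coefficients.  As the circumcentre has inner product 1 with the
    normalized corners, [<y, O>] is the sum of the norms of the three terms. *)
Lemma chamber_covering (y : 'cV[R]_3) : dot y y = 1 ->
  dot y (mirror_x *m circumcenter R) <= dot y (circumcenter R) ->
  dot y (mirror_y *m circumcenter R) <= dot y (circumcenter R) ->
  dot y (mirror_oblique *m circumcenter R) <= dot y (circumcenter R) ->
  1 <= dot y (circumcenter R).
Proof.
rewrite (vec3_eta y) /circumcenter !mat3_vec !vec3_dot.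
move: (y i0 0) (y i1 0) (y i2 0) => {}y0 y1 y2.
have g2 := golden_sqr R; have t2 := vertex_norm_sqr R.
have s2 : s3 ^+ 2 = 3 by rewrite sqr_sqrtr.
have [a0 d0 w] := circumcenter_weights R.
have g0 : 0 < phi by have /andP [? _] := golden_coarse R; lra.
move: (phi) (tau) (s3) g2 t2 s2 a0 d0 w g0 => g t s g2 t2 s2 a0 d0 w g0.
have ox : 0 < s * g - g ^+ 2 by rewrite expr2 -mulrBl mulr_gt0.
move=> yy mx my mn.
have x0 : 0 <= y0 by rewrite -(pmulr_lge0 _ ox); lra.
have x1 : 0 <= y1 by rewrite -(pmulr_lge0 _ a0); lra.
(* [nO] and [ny] are twice the inner products of [O] and [y] with the normal of
   the third wall. *)
have nO : 0 < g - 1 - (t - g) - g * (s * g - g ^+ 2).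
  rewrite -(pmulr_rgt0 _ g0).
  have -> : g * (g - 1 - (t - g) - g * (s * g - g ^+ 2)) =
    (g ^+ 2 - g) - g * (t - g) - g ^+ 2 * g * (s - g) by ring.
  have -> : g ^+ 2 * g = 2 * g + 1 by rewrite g2 mulrDl -expr2 g2; ring.
  by rewrite g2; lra.
have ny : 0 <= (g - 1) * y2 - y1 - g * y0.
  rewrite -(pmulr_rge0 _ nO).
  move: (s * g - g ^+ 2) (t - g) mn => a b mn.
  have -> : (g - 1 - b - g * a) * ((g - 1) * y2 - y1 - g * y0) =
    g ^+ 2 * ((1 - a) * (y2 - y0))
    + g * ((1 - a) * (- (y2 + y1)) + (- 1 - b) * (y2 - y0)) + (- 1 - b) * (- (y2 + y1)).
    by ring.
  by rewrite g2; lra.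
have h0 : 0 <= y2 - g ^+ 2 * y0 - g * y1.
  have -> : y2 - g ^+ 2 * y0 - g * y1 = g * ((g - 1) * y2 - y1 - g * y0).
    have -> : g * ((g - 1) * y2 - y1 - g * y0) = (g ^+ 2 - g) * y2 - g ^+ 2 * y0 - g * y1 by ring.
    by rewrite g2; ring.
  by rewrite mulr_ge0 // ltW.
set h := y2 - _ - _ in h0.
have y2E : y2 = h + g ^+ 2 * y0 + g * y1 by rewrite /h; ring.
clearbody h.
have e1 : t ^+ 2 - 1 - g ^+ 2 = 0 by rewrite t2 g2; ring.
have e2 : s ^+ 2 * g ^+ 2 - 1 - g ^+ 2 * g ^+ 2 = 0.
  by rewrite s2 g2; lra.
have -> : y0 * (s * g - g ^+ 2) + y1 * (t - g) + y2 * 1 = h + t * y1 + s * g * y0.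
  by rewrite y2E; ring.
have T0 : 0 <= h + t * y1 + s * g * y0.
  by rewrite !addr_ge0 ?mulr_ge0 //; lra.
have ts : 0 <= t * s - g ^+ 2 by nra.
(* The square of the triangle inequality for the three terms of [y]. *)
have T2 : (h + t * y1 + s * g * y0) ^+ 2 =
    1 + 2 * (h * y1 * (t - g)) + 2 * (h * y0 * (s * g - g ^+ 2))
    + 2 * (y0 * y1 * (g * (t * s - g ^+ 2))).
  have -> : (h + t * y1 + s * g * y0) ^+ 2 = (y0 * y0 + y1 * y1 + y2 * y2)
    + 2 * (h * y1 * (t - g)) + 2 * (h * y0 * (s * g - g ^+ 2))
    + 2 * (y0 * y1 * (g * (t * s - g ^+ 2)))
    + y1 ^+ 2 * (t ^+ 2 - 1 - g ^+ 2)
    + y0 ^+ 2 * (s ^+ 2 * g ^+ 2 - 1 - g ^+ 2 * g ^+ 2) by rewrite y2E; ring.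
  by rewrite yy e1 e2 !mulr0 !addr0.
rewrite -(ler_pXn2r (n := 2)) ?nnegrE // expr1n T2.
have p1 : 0 <= h * y1 * (t - g) by rewrite !mulr_ge0 // ltW.
have p2 : 0 <= h * y0 * (s * g - g ^+ 2) by rewrite !mulr_ge0 // ltW.
have p3 : 0 <= y0 * y1 * (g * (t * s - g ^+ 2)) by rewrite !mulr_ge0 // ltW.
lra.
Qed.

Lemma icosahedral_covering (b : 'cV[R]_3) : dot b b = 1 ->
  exists2 g, icosahedral_group g & 1 <= dot b (g *m circumcenter R).
Proof.
move=> b1; have [fin GO G1 GM _] := icosahedral_group_subgroup.
have [g Gg gmax] := @finite_argmax _ _ _ (fun g => dot b (g *m circumcenter R)) fin
  (ex_intro _ _ G1).
exists g => //.
have wall h : icosahedral_group h ->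
    dot (g^T *m b) (h *m circumcenter R) <= dot (g^T *m b) (circumcenter R).
  by move=> Gh; rewrite -!dot_mxE mulmxA; apply: gmax; apply: GM.
rewrite dot_mxE; apply: chamber_covering; last 3 first.
- exact/wall/mirror_x_icosahedral.
- exact/wall/mirror_y_icosahedral.
- exact/wall/mirror_oblique_icosahedral.
by rewrite -dot_mxE mulmxA O3_trC ?mul1mx //; apply: GO.
Qed.

End IcosahedralGroup.
Arguments icosahedral_group R : clear implicits.

Lemma covering_sin_approx (R : realType) :
  `| covering_sin R - 3208%:R / 10%:R ^+ 4 | <= 5%:R / 10%:R ^+ 5.
Proof.
have /andP [c_lo c_hi] := covering_cos_sqr_bounds R.
have /andP [s_lo s_hi] : 17 / 53 < covering_sin R < 197 / 614.
  by apply: sqrt_between; lra.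
by rewrite ler_norml; apply/andP; split; lra.
Qed.

Theorem theorem1p1 (R : realType) :
  exists X : set 'cV[R]_3,
    optimal_approximation X (unit_sphere R) /\
    `| hausdorff_distance X (unit_sphere R) - 3208%:R / 10%:R ^+ 4 |
      <= 5%:R / 10%:R ^+ 5.
Proof.
have GG := icosahedral_group_subgroup R.
pose X := orbit3 (icosahedral_group R) (covering_cos R ^+ 2 *: circumcenter R).
have XH : finite_homogeneous X.
  by exists (icosahedral_group R), (covering_cos R ^+ 2 *: circumcenter R).
have XE : hausdorff_distance X (unit_sphere R) = covering_sin R.
  apply/eqP; rewrite eq_le hausdorff_distance_orbit_ge // andbT.
  by apply: hausdorff_distance_orbit_le => //; apply: icosahedral_covering.
exists X; split; last by rewrite XE; apply: covering_sin_approx.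
by split=> // Y YH; rewrite XE; apply: hausdorff_distance_orbit_ge.
Qed.
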